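(* Let $K$ be a finite simplicial complex and let $a$ be a $0$-simplex. Denote by $K_a$ the component of $a$ in $K$ and denote also by $a$ the corresponding generator of degree $-1$ in $\mathfrak{L}(K)$. Then the injection $$(\mathfrak{L}(K_a),\partial_a)\stackrel{\simeq}{\longrightarrow}(\mathfrak{L}(K),\partial_a)$$ is a quasi-isomorphism.
   Context: The base field is $\mathbb{Q}$. A differential graded Lie algebra (DGL) is a $\mathbb{Z}$-graded Lie algebra $L$ with a linear derivation $\partial$ of degree $-1$, $\partial^2=0$; with $L^1=L$, $L^n=[L,L^{n-1}]$, it is complete if $L\cong\varprojlim_n L/L^n$. $\widehat{\mathbb{L}}(V)=\varprojlim_n\mathbb{L}(V)/\mathbb{L}^{>n}(V)$ is the completion of the free graded Lie algebra $\mathbb{L}(V)$. For a differential $\partial$ on $\widehat{\mathbb L}(V)$, $\partial_1$ is its linear part. A Maurer-Cartan element is $a\in L_{-1}$ with $\partial a+\frac12[a,a]=0$; then $\partial_a=\partial+\mathrm{ad}_a$ is again a differential on $L$. $\widehat{\mathbb{L}}(\Delta^n)$ denotes the free complete graded Lie algebra on generators $a_{i_0\dots i_p}$ of degree $p-1$, one for each $0\le i_0<\dots<i_p\le n$, $0\le p\le n$. Let $d a_{i_0\dots i_p}=\sum_{j=0}^p(-1)^ja_{i_0\dots\widehat{i_j}\dots i_p}$ ($da_i=0$), and let $\delta_i\colon\widehat{\mathbb{L}}(\Delta^{n-1})\to\widehat{\mathbb{L}}(\Delta^n)$, $0\le i\le n$, be $\delta_i(a_{j_0\dots j_p})=a_{\ell_0\dots\ell_p}$,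 with $\ell_k=j_k$ if $j_k<i$ and $\ell_k=j_k+1$ if $j_k\ge i$. A sequence of compatible models of $\mathbf\Delta$ is a family of complete DGL's $\{\mathfrak{L}_n=(\widehat{\mathbb{L}}(\Delta^n),\partial)\}_{n\ge0}$ such that: (1) each $a_i$ is a Maurer-Cartan element; (2) $\partial_1=d$; (3) each $\delta_i$ is a DGL morphism. Fix such a sequence (it exists and is unique up to isomorphism compatible with the cofaces). For a finite simplicial complex $K$, choose an embedding $K\subset\Delta^n$ as a subcomplex; $\mathfrak{L}(K)$ is the complete sub-DGL $(\widehat{\mathbb{L}}(V),\partial)\subset\mathfrak{L}_n$, where $V$ is spanned by the generators corresponding to simplices of $K$, so that $(V,\partial_1)$ is the desuspended simplicial chain complex of $K$. A subcomplex of $K$ gives a sub-DGL of $\mathfrak{L}(K)$. *)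

(* Defs.v *)
From HB Require Import structures.
From mathcomp Require Import all_boot all_order all_algebra.
From mathcomp Require Import boolp functions.
From mathcomp Require Import ring zify.

Set Implicit Arguments.
Unset Strict Implicit.
Unset Printing Implicit Defensive.

Import GRing.Theory.
Local Open Scope ring_scope.
Local Open Scope quotient_scope.

(* The bracket [L_p x L_q -> L_(p+q)] takes the target degree [r] and a proof of
   [p + q = r] as arguments, so that no transport along equalities of degrees
   is needed in the axioms; the same device is used for differentials.
   Over a field of characteristic 0, no axiom is needed for [x, x] with x of even
   degree nor for [x, [x, x]] with x of odd degree. *)
Record gla := GLA {
  gl_sort :> int -> lmodType rat;
  br : forall p q r : int, p + q = r -> gl_sort p -> gl_sort q -> gl_sort r;
  br_linl : forall p q r (h : p + q = r) y, linear (fun x => br h x y);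
  br_linr : forall p q r (h : p + q = r) x, linear (br h x);
  br_anti : forall p q r (h : p + q = r) (h' : q + p = r) x y,
    br h x y = - ((-1) ^ (p * q) *: br h' y x);
  br_jacobi : forall p q s pq qs ps t (hpq : p + q = pq) (hqs : q + s = qs)
      (hps : p + s = ps) (h1 : p + qs = t) (h2 : pq + s = t) (h3 : q + ps = t)
      x y z,
    br h1 x (br hqs y z)
    = br h2 (br hpq x y) z + (-1) ^ (p * q) *: br h3 y (br hps x z)
}.

Record differential (L : gla) := Differential {
  dif : forall p q : int, p - 1 = q -> L p -> L q;
  dif_lin : forall p q (h : p - 1 = q), linear (dif h);
  dif_br : forall p q r p' q' r' (h : p + q = r) (hp : p - 1 = p')
      (hq : q - 1 = q') (hr : r - 1 = r') (h1 : p' + q = r') (h2 : p + q' = r')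
      x y,
    dif hr (br h x y)
    = br h1 (dif hp x) y + (-1) ^ p *: br h2 x (dif hq y);
  dif_dif : forall p q r (h : p - 1 = q) (h' : q - 1 = r) x,
    dif h' (dif h x) = 0
}.

Record dgl := DGL { dgl_gla :> gla; dgl_dif : differential dgl_gla }.

Definition d (L : dgl) p q (h : p - 1 = q) : L p -> L q := dif (dgl_dif L) h.

HB.instance Definition _ (L : gla) p q r (h : p + q = r) (x : L p) :=
  GRing.isLinear.Build rat (L q) (L r) *:%R (br h x) (br_linr h x).
HB.instance Definition _ (L : gla) (D : differential L) p q (h : p - 1 = q) :=
  GRing.isLinear.Build rat (L p) (L q) *:%R (dif D h) (dif_lin D h).
HB.instance Definition _ (L : dgl) p q (h : p - 1 = q) :=
  GRing.isLinear.Build rat (L p) (L q) *:%R (@d L p q h)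
    (dif_lin (dgl_dif L) h).

Record gla_mor (L L' : gla) := GLAMor {
  gm_fun :> forall p, L p -> L' p;
  gm_lin : forall p, linear (@gm_fun p);
  gm_br : forall p q r (h : p + q = r) x y,
    gm_fun (br h x y) = br h (gm_fun x) (gm_fun y)
}.
Arguments gm_fun {L L'} f {p} : rename.

HB.instance Definition _ (L L' : gla) (f : gla_mor L L') p :=
  GRing.isLinear.Build rat (L p) (L' p) *:%R (@gm_fun L L' f p) (@gm_lin L L' f p).

Definition dif_compat (L L' : dgl) (f : gla_mor L L') : Prop :=
  forall p q (h : p - 1 = q) x, f q (d h x) = d h (f p x).

Record dgl_mor (L L' : dgl) := DGLMor {
  dm_gla :> gla_mor L L';
  dm_dif : dif_compat dm_gla
}.

Section Homology.
Variables (L : dgl) (p : int).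

Definition is_cycle : {pred L p} := [pred x | d (erefl (p - 1)) x == 0].

Lemma is_cycle_submod : submod_closed is_cycle.
Proof.
split=> [|c x y]; rewrite !inE; first by rewrite raddf0.
by move=> /eqP hx /eqP hy; rewrite linearP /= hx hy scaler0 addr0.
Qed.
HB.instance Definition _ :=
  GRing.isSubmodClosed.Build rat (L p) is_cycle is_cycle_submod.

Record cycle := Cycle { cycle_val : L p; cycleP : cycle_val \in is_cycle }.
HB.instance Definition _ := [isSub for cycle_val].
HB.instance Definition _ := [Choice of cycle by <:].
HB.instance Definition _ := [SubChoice_isSubLmodule of cycle by <:].

Definition boundary : {pred cycle} :=
  fun z => `[< exists y : L (p + 1), d (addrK 1 p) y = val z >].

Lemma boundary_zmod : zmod_closed boundary.
Proof.
split=> [|x y]; first by apply/asboolP; exists 0; rewrite raddf0.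
move=> /asboolP[u hu] /asboolP[v hv]; apply/asboolP; exists (u - v).
by rewrite raddfB /= hu hv.
Qed.
HB.instance Definition _ :=
  GRing.isZmodClosed.Build cycle boundary boundary_zmod.

Definition homology := Quotient.quot boundary.
HB.instance Definition _ := Quotient.on homology.
HB.instance Definition _ := GRing.Zmodule.on homology.

End Homology.

Section HomologyMap.
Variables (L L' : dgl) (f : dgl_mor L L') (p : int).

Lemma cycle_map_subproof (z : cycle L p) : f p (val z) \in @is_cycle L' p.
Proof.
case: z => x hx /=; move: hx; rewrite !inE => /eqP hx.
by rewrite -dm_dif hx raddf0.
Qed.

Definition cycle_map (z : cycle L p) : cycle L' p := Cycle (cycle_map_subproof z).

(* Well defined on homology classes, see [homology_mapE]. *)
Definition homology_map (c : homology L p) : homology L' p :=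
  \pi_(homology L' p) (cycle_map (repr c)).

Lemma homology_mapE (z : cycle L p) :
  homology_map (\pi_(homology L p) z) = \pi_(homology L' p) (cycle_map z).
Proof.
rewrite /homology_map; apply/eqP; rewrite -Quotient.idealrBE.
case: (piP (homology L p) z) => z' /eqP.
rewrite eq_sym -Quotient.idealrBE => /asboolP[y hy]; apply/asboolP.
by exists (f _ y); rewrite -dm_dif hy /= raddfB.
Qed.
End HomologyMap.

Definition quasi_iso (L L' : dgl) (f : dgl_mor L L') : Prop :=
  forall p, bijective (@homology_map L L' f p).

Lemma degMC : -1 + -1 = -2 :> int. Proof. by []. Qed.

Definition maurer_cartan (L : dgl) (a : L (-1)) : Prop :=
  d (erefl : -1 - 1 = -2 :> int) a + 2^-1 *: br degMC a a = 0.

Section Twist.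
Variables (L : dgl) (a : L (-1)) (ha : maurer_cartan a).

Lemma twist_deg p q : p - 1 = q -> -1 + p = q :> int.
Proof. by rewrite addrC. Qed.

Definition twist_fun p q (h : p - 1 = q) (x : L p) : L q :=
  d h x + br (twist_deg h) a x.

Lemma twist_lin p q (h : p - 1 = q) : linear (twist_fun h).
Proof. by move=> c x y; rewrite /twist_fun !linearP /= scalerDr addrACA. Qed.

Lemma twist_br p q r p' q' r' (h : p + q = r) (hp : p - 1 = p')
    (hq : q - 1 = q') (hr : r - 1 = r') (h1 : p' + q = r') (h2 : p + q' = r')
    x y :
  twist_fun hr (br h x y)
  = br h1 (twist_fun hp x) y + (-1) ^ p *: br h2 x (twist_fun hq y).
Proof.
rewrite /twist_fun.
have -> : d hr (br h x y) = br h1 (d hp x) y + (-1) ^ p *: br h2 x (d hq y).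
  exact: dif_br.
rewrite (br_jacobi (twist_deg hp) h (twist_deg hq) (twist_deg hr) h1 h2) mulN1r.
have := br_linl h1 y 1 (d hp x) (br (twist_deg hp) a x).
rewrite /= !scale1r => ->; rewrite raddfD /= scalerDr addrACA.
by rewrite -exprz_inv invrN1.
Qed.

Lemma twist_sq p q r (h : p - 1 = q) (h' : q - 1 = r) x :
  twist_fun h' (twist_fun h x) = 0.
Proof.
rewrite /twist_fun !raddfD /=.
have -> : d h' (d h x) = 0 by exact: dif_dif.
rewrite add0r.
have e : -2 + p = r by rewrite -h' -h -addrA addrC.
have -> : d h' (br (twist_deg h) a x)
   = br e (d (erefl : -1 - 1 = -2 :> int) a) x - br (twist_deg h') a (d h x).
  rewrite /d (dif_br (dgl_dif L) (twist_deg h) (erefl : -1 - 1 = -2 :> int)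
     h h' e (twist_deg h')); congr (_ + _).
  by rewrite exprN1 invrN1 scaleN1r.
rewrite addrA subrK.
have := br_jacobi degMC (twist_deg h) (twist_deg h) (twist_deg h') e (twist_deg h') a a x.
set J := br (twist_deg h') a _; set I := br e (br _ a a) x => hJ.
have {hJ} hJ : J = 2^-1 *: I.
  have : J + J = I by rewrite {1}hJ mulrNN mulr1 expr1z scaleN1r subrK.
  by rewrite -mulr2n -scaler_nat => <-; rewrite scalerA mulVf ?scale1r.
rewrite hJ /I.
have := br_linl e x 2^-1 (br degMC a a) (d (erefl : -1 - 1 = -2 :> int) a).
rewrite /= [X in br e X x]addrC ha => H; rewrite addrC -H.
have := br_linl e x (-1) 0 0; rewrite /= scaler0 addr0 => ->.
by rewrite scaleN1r addNr.
Qed.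

Definition twist : dgl :=
  DGL (Differential twist_lin twist_br twist_sq).
End Twist.

Section TwistMor.
Variables (L L' : dgl) (f : dgl_mor L L') (a : L (-1)) (a' : L' (-1)).
Variables (ha : maurer_cartan a) (ha' : maurer_cartan a') (fa : f _ a = a').

Lemma twist_mor_dif :
  @dif_compat (twist ha) (twist ha') (dm_gla f).
Proof.
move=> p q h x; rewrite /d /= /twist_fun raddfD /=.
by rewrite dm_dif gm_br fa.
Qed.

Definition twist_mor : dgl_mor (twist ha) (twist ha') := DGLMor twist_mor_dif.
End TwistMor.

Record subdgl (L : dgl) := SubDGL {
  sub_pred : forall p, {pred L p};
  sub_submod : forall p, submod_closed (@sub_pred p);
  sub_br : forall (p q r : int) (h : p + q = r) x y,
    x \in @sub_pred p -> y \in @sub_pred q -> br h x y \in @sub_pred r;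
  sub_d : forall (p q : int) (h : p - 1 = q) x,
    x \in @sub_pred p -> d h x \in @sub_pred q
}.

Section SubDGL.
Variables (L : dgl) (C : subdgl L).

Section Piece.
Variable p : int.
Definition subdgl_pred : {pred L p} := @sub_pred L C p.
HB.instance Definition _ :=
  GRing.isSubmodClosed.Build rat (L p) subdgl_pred (@sub_submod L C p).
Record subdgl_elt :=
  SubdglElt { subdgl_val : L p; subdgl_valP : subdgl_val \in subdgl_pred }.
HB.instance Definition _ := [isSub for subdgl_val].
HB.instance Definition _ := [Choice of subdgl_elt by <:].
HB.instance Definition _ := [SubChoice_isSubLmodule of subdgl_elt by <:].
End Piece.

Definition subdgl_br p q r (h : p + q = r) (x : subdgl_elt p) (y : subdgl_elt q)
    : subdgl_elt r :=
  SubdglElt (sub_br h (subdgl_valP x) (subdgl_valP y)).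

Definition subdgl_d p q (h : p - 1 = q) (x : subdgl_elt p) : subdgl_elt q :=
  SubdglElt (sub_d h (subdgl_valP x)).

Definition subdgl_gla : gla.
Proof.
apply: (@GLA (fun p => subdgl_elt p : lmodType rat) subdgl_br).
- by move=> p q r h y c x x'; apply: val_inj; rewrite /= br_linl.
- by move=> p q r h x c y y'; apply: val_inj; rewrite /= br_linr.
- by move=> p q r h h' x y; apply: val_inj => /=; apply: br_anti.
- by move=> *; apply: val_inj => /=; apply: br_jacobi.
Defined.

Definition subdgl_dif : differential subdgl_gla.
Proof.
apply: (@Differential subdgl_gla subdgl_d).
- by move=> p q h c x y; apply: val_inj; rewrite /= linearP.
- by move=> p q r p' q' r' h hp hq hr h1 h2 x y; apply: val_inj => /=;
    apply: dif_br.
- by move=> p q r h h' x; apply: val_inj => /=; apply: dif_dif.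
Defined.

Definition subdgl_dgl : dgl := DGL subdgl_dif.
End SubDGL.

Section SubIncl.
Variables (L : dgl) (C D : subdgl L).
Hypothesis CD : forall p, {subset @sub_pred L C p <= @sub_pred L D p}.

Definition incl_fun p (x : subdgl_dgl C p) : subdgl_dgl D p :=
  SubdglElt (CD (subdgl_valP x)).

Definition incl_gla : gla_mor (subdgl_dgl C) (subdgl_dgl D).
Proof.
apply: (@GLAMor _ _ incl_fun).
- by move=> p c x y; apply: val_inj.
- by move=> p q r h x y; apply: val_inj.
Defined.

Lemma incl_dif : dif_compat incl_gla.
Proof. by move=> p q h x; apply: val_inj. Qed.

Definition incl : dgl_mor (subdgl_dgl C) (subdgl_dgl D) := DGLMor incl_dif.
End SubIncl.

(* Noncommutative formal power series over the alphabet [X]: the completed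
   tensor algebra on the vector space with basis [X]. *)
Section Series.
Variable X : finType.
Notation series := (seq X -> rat^o).
Implicit Types (f g h : series) (w : seq X).

Lemma serD f g w : (f + g) w = f w + g w. Proof. by []. Qed.
Lemma serN f w : (- f) w = - f w. Proof. by []. Qed.
Lemma serZ c f w : (c *: f) w = c * f w. Proof. by []. Qed.
Lemma ser0 w : (0 : series) w = 0. Proof. by []. Qed.
Lemma ser_sum (I : Type) (r : seq I) (P : pred I) (F : I -> series) w :
  (\sum_(i <- r | P i) F i) w = \sum_(i <- r | P i) F i w.
Proof. by rewrite fct_sumE. Qed.
Definition serE := (serD, serN, serZ, ser0, ser_sum).

Definition smul f g : series :=
  fun w => \sum_(i < (size w).+1) f (take i w) * g (drop i w).

Definition letter (x : X) : series := fun w => (w == [:: x])%:R.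

Definition sbr (p q : int) f g : series :=
  smul f g - (-1) ^ (p * q) *: smul g f.

(* Component of word length [k]. *)
Definition part (k : nat) f : series := fun w => if size w == k then f w else 0.

(* [lie deg S k p f]: [f] lies in the part of word length [k] and degree [p] of
   the free graded Lie algebra on [S], realized as the graded Lie subalgebra of
   the tensor algebra generated by [S] (in characteristic 0 this is free, by the
   Poincare-Birkhoff-Witt theorem). *)
Inductive lie (deg : X -> int) (S : {set X}) : nat -> int -> series -> Prop :=
| lie_letter x : x \in S -> lie deg S 1 (deg x) (letter x)
| lie_zero k p : lie deg S k p 0
| lie_lin k p c f g :
    lie deg S k p f -> lie deg S k p g -> lie deg S k p (c *: f + g)
| lie_br k l p q f g :
    lie deg S k p f -> lie deg S l q g -> lie deg S (k + l) (p + q) (sbr p q f g).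

(* Degree [p] part of the completion. As the word length filtration of the free
   graded Lie algebra splits, the limit of the quotients by word length [> n] is,
   in each degree [p], the product over [k] of the parts of word length [k]. *)
Definition lhat (deg : X -> int) (S : {set X}) (p : int) f : Prop :=
  forall k, lie deg S k p (part k f).

Definition lder (x : X) f : series := fun w => f (x :: w).

Lemma smul_nil f g : smul f g [::] = f [::] * g [::].
Proof. by rewrite /smul big_ord_recl big_ord0 addr0. Qed.

Lemma smul_cons f g x w :
  smul f g (x :: w) = f [::] * g (x :: w) + smul (lder x f) g w.
Proof. by rewrite /smul /= big_ord_recl. Qed.

Lemma smulPl c f f' g : smul (c *: f + f') g = c *: smul f g + smul f' g.
Proof.
apply/funext => w; rewrite !serE /smul mulr_sumr -big_split /=.
by apply: eq_bigr => i _; rewrite !serE mulrDl mulrA.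
Qed.

Lemma smulPr c f g g' : smul f (c *: g + g') = c *: smul f g + smul f g'.
Proof.
apply/funext => w; rewrite !serE /smul mulr_sumr -big_split /=.
by apply: eq_bigr => i _; rewrite !serE mulrDr mulrCA.
Qed.

HB.instance Definition _ f := GRing.isLinear.Build rat series series *:%R (smul f)
  (fun c g g' => smulPr c f g g').

Lemma smulA f g h : smul f (smul g h) = smul (smul f g) h.
Proof.
apply/funext => w; elim: w f g h => [|x w IHw] f g h.
  by rewrite !smul_nil mulrA.
rewrite !smul_cons IHw smul_nil mulrDr mulrA.
rewrite -addrA; congr (_ + _).
have -> : lder x (smul f g) = f [::] *: lder x g + smul (lder x f) g.
  by apply/funext => v; rewrite /lder smul_cons !serE.
by rewrite smulPl !serE.
Qed.

Lemma sbr_linl p q g : linear (fun f => sbr p q f g).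
Proof.
move=> c f f'; rewrite /sbr smulPl smulPr.
by rewrite scalerDr !scalerA mulrC -scalerA opprD addrACA -scalerBr.
Qed.

Lemma sbr_linr p q f : linear (sbr p q f).
Proof.
move=> c g g'; rewrite /sbr smulPl smulPr.
by rewrite scalerDr !scalerA mulrC -scalerA opprD addrACA -scalerBr.
Qed.

HB.instance Definition _ p q f :=
  GRing.isLinear.Build rat series series *:%R (sbr p q f) (sbr_linr p q f).

Definition sbrr p q g f := sbr p q f g.
HB.instance Definition _ p q g :=
  GRing.isLinear.Build rat series series *:%R (sbrr p q g) (sbr_linl p q g).

Lemma sgn_sq (k : int) : (-1) ^ k * (-1) ^ k = 1 :> rat.
Proof. by rewrite -expfzMl mulrNN mulr1 exp1rz. Qed.

Lemma sgnD (k l : int) : (-1) ^ (k + l) = (-1) ^ k * (-1) ^ l :> rat.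
Proof. by rewrite expfzDr. Qed.

Lemma sbr_anti p q f g : sbr p q f g = - ((-1) ^ (p * q) *: sbr q p g f).
Proof.
by rewrite /sbr scalerBr scalerA [q * p]mulrC sgn_sq scale1r opprB.
Qed.

Lemma sbr_jacobi p q s f g h :
  sbr p (q + s) f (sbr q s g h)
  = sbr (p + q) s (sbr p q f g) h
    + (-1) ^ (p * q) *: sbr q (p + s) g (sbr p s f h).
Proof.
rewrite /sbr; set a := (-1) ^ (p * q); set b := (-1) ^ (q * s).
set c := (-1) ^ (p * s).
have -> : (-1) ^ (p * (q + s)) = a * c :> rat by rewrite mulrDr sgnD.
have -> : (-1) ^ ((p + q) * s) = c * b :> rat by rewrite mulrDl sgnD.
have -> : (-1) ^ (q * (p + s)) = a * b :> rat by rewrite mulrDr sgnD [q * p]mulrC.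
have aa : a * a = 1 by exact: sgn_sq.
have Bl u v t k : smul (u - k *: v) t = smul u t - k *: smul v t.
  by rewrite addrC -scaleNr smulPl scaleNr addrC.
have Br u v t k : smul t (u - k *: v) = smul t u - k *: smul t v.
  by rewrite addrC -scaleNr smulPr scaleNr addrC.
have a1 : a = 1 \/ a = -1.
  have /orP[/eqP|/eqP] : (a == 1) || (a == -1) by rewrite -sqrf_eq1 expr2 aa.
    by left.
  by right.
rewrite !Bl !Br !smulA; apply/funext => w; rewrite !serE.
by case: a1 => ->; ring.
Qed.

Lemma part_lin k c f g : part k (c *: f + g) = c *: part k f + part k g.
Proof.
by apply/funext => w; rewrite !serE /part; case: ifP => // _; rewrite mulr0 addr0.
Qed.
HB.instance Definition _ k := GRing.isLinear.Build rat series series *:%R (part k)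
  (fun c f g => part_lin k c f g).

Lemma part_part j k f : part j (part k f) = if j == k then part k f else 0.
Proof.
apply/funext => w; rewrite /part; case: (eqVneq j k) => [->|jk].
  by case: (size w == k).
by case: ifP => // /eqP->; rewrite (negbTE jk).
Qed.

Lemma part_smul k f g :
  part k (smul f g) = \sum_(i < k.+1) smul (part i f) (part (k - i) g).
Proof.
apply/funext => w; rewrite serE /part.
under eq_bigr => i _ do rewrite /smul.
case: eqP => [<-|kw].
  rewrite /smul.
  rewrite exchange_big /=; apply: eq_bigr => i _.
  rewrite (bigD1 i) //= big1 ?addr0.
    by rewrite size_takel -1?ltnS // size_drop !eqxx.
  move=> j ji; rewrite size_takel -1?ltnS //.
  by rewrite eq_sym (inj_eq val_inj) (negbTE ji) mul0r.
rewrite big1 // => i _; rewrite big1 // => j _.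
rewrite size_takel -1?ltnS // size_drop.
case: eqP => [ji|_]; last by rewrite mul0r.
case: eqP => [e|_]; last by rewrite mulr0.
by case: kw; have := ltn_ord i; have := ltn_ord j; lia.
Qed.

Lemma part_sbr k p q f g :
  part k (sbr p q f g) = \sum_(i < k.+1) sbr p q (part i f) (part (k - i) g).
Proof.
rewrite /sbr raddfB /= linearZ /= !part_smul sumrB; congr (_ - _).
rewrite scaler_sumr (reindex_inj rev_ord_inj) /=; apply: eq_bigr => i _.
by rewrite subSS subKn // -ltnS.
Qed.

Section Lie.
Variable deg : X -> int.
Implicit Types S : {set X}.

Lemma lieD S k p f g : lie deg S k p f -> lie deg S k p g -> lie deg S k p (f + g).
Proof. by move=> hf hg; rewrite -[f]scale1r; apply: lie_lin. Qed.

Lemma lieZ S k p c f : lie deg S k p f -> lie deg S k p (c *: f).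
Proof. by move=> hf; rewrite -[_ *: _]addr0; apply: lie_lin => //; apply: lie_zero. Qed.

Lemma lie_sum S k p (I : Type) (r : seq I) (P : pred I) (F : I -> series) :
  (forall i, P i -> lie deg S k p (F i)) -> lie deg S k p (\sum_(i <- r | P i) F i).
Proof.
move=> hF; apply: (big_ind (lie deg S k p)) => //; first exact: lie_zero.
by move=> f g; apply: lieD.
Qed.

Lemma lie_part S k p f : lie deg S k p f -> part k f = f.
Proof.
elim=> {k p f} [x xS|k p|k p c f g _ hf _ hg|k l p q f g _ hf _ hg].
- by apply/funext => w; rewrite /part /letter; case: eqP => // w1; case: eqP => // e; rewrite e in w1.
- by rewrite raddf0.
- by rewrite linearP /= hf hg.
rewrite part_sbr; have kl : (k < (k + l).+1)%N by lia.
rewrite (bigD1 (Ordinal kl)) //= addKn hf hg big1 ?addr0 // => i ik.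
rewrite -hf part_part ifN; last by apply: contra ik => /eqP e; apply/eqP/val_inj.
by rewrite -/(sbrr _ _ _ _) raddf0.
Qed.

Lemma lie0 S p f : lie deg S 0 p f -> f = 0.
Proof.
move: {2 3}0%N (erefl 0%N) => k k0 hf.
elim: hf k0 => {k p f} [x xS|k p|k p c f g _ hf _ hg|k l p q f g _ hf _ hg] //.
  by move=> k0; rewrite hf ?hg // scaler0 addr0.
by move=> kl; rewrite hg ?raddf0 //; lia.
Qed.

Lemma lie_lhat S k p f : lie deg S k p f -> lhat deg S p f.
Proof.
move=> hf j; rewrite -(lie_part hf) part_part.
case: eqP => [->|_]; last exact: lie_zero.
by rewrite (lie_part hf).
Qed.

Lemma lie_sub S S' k p f : S \subset S' -> lie deg S k p f -> lie deg S' k p f.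
Proof.
move=> /subsetP SS'; elim=> {k p f} [x xS|k p|k p c f g _ hf _ hg|k l p q f g _ hf _ hg].
- exact/lie_letter/SS'.
- exact: lie_zero.
- exact: lie_lin.
- exact: lie_br.
Qed.

Lemma lhat_sub S S' p f : S \subset S' -> lhat deg S p f -> lhat deg S' p f.
Proof. by move=> SS' hf k; apply: lie_sub (hf k). Qed.

Lemma lhat0 S p : lhat deg S p 0.
Proof. by move=> k; rewrite raddf0; apply: lie_zero. Qed.

Lemma lhat_lin S p c f g :
  lhat deg S p f -> lhat deg S p g -> lhat deg S p (c *: f + g).
Proof. by move=> hf hg k; rewrite linearP; apply: lie_lin. Qed.

Lemma lhat_br S p q f g :
  lhat deg S p f -> lhat deg S q g -> lhat deg S (p + q) (sbr p q f g).
Proof.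
move=> hf hg k; rewrite part_sbr; apply: lie_sum => i _.
rewrite -{1}(@subnKC i k) -1?ltnS //; exact: lie_br.
Qed.

Lemma lhat_letter S x : x \in S -> lhat deg S (deg x) (letter x).
Proof. by move=> xS; apply: lie_lhat (lie_letter _ xS). Qed.

Section Piece.
Variable p : int.
Definition free_pred : {pred series} := fun f => `[< lhat deg setT p f >].
Lemma free_submod : submod_closed free_pred.
Proof.
split=> [|c f g]; first by apply/asboolP/lhat0.
by move=> /asboolP hf /asboolP hg; apply/asboolP/lhat_lin.
Qed.
HB.instance Definition _ :=
  GRing.isSubmodClosed.Build rat series free_pred free_submod.
Record free_elt := FreeElt { free_val : series; free_valP : free_val \in free_pred }.
HB.instance Definition _ := [isSub for free_val].
HB.instance Definition _ := [Choice of free_elt by <:].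
HB.instance Definition _ := [SubChoice_isSubLmodule of free_elt by <:].
End Piece.

Lemma free_lhat p (f : free_elt p) : lhat deg setT p (free_val f).
Proof. by apply/asboolP; apply: free_valP. Qed.

Lemma free_br_subproof p q r (h : p + q = r) (f : free_elt p) (g : free_elt q) :
  sbr p q (free_val f) (free_val g) \in free_pred r.
Proof. by rewrite -h; apply/asboolP/lhat_br; apply: free_lhat. Qed.

Definition free_br p q r (h : p + q = r) (f : free_elt p) (g : free_elt q) :
  free_elt r := FreeElt (free_br_subproof h f g).

Definition free_gla : gla.
Proof.
apply: (@GLA (fun p => free_elt p : lmodType rat) free_br).
- by move=> p q r h g c f f'; apply: val_inj; apply: sbr_linl.
- by move=> p q r h f c g g'; apply: val_inj; apply: sbr_linr.
- by move=> p q r h h' f g; apply: val_inj; apply: sbr_anti.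
- move=> p q s pq qs ps t hpq hqs hps h1 h2 h3 f g h; apply: val_inj => /=.
  by rewrite -hpq -hqs -hps; apply: sbr_jacobi.
Defined.

Lemma gen_subproof x p : deg x = p -> letter x \in free_pred p.
Proof. by move<-; apply/asboolP/lhat_letter; rewrite inE. Qed.

Definition gen x p (h : deg x = p) : free_gla p := FreeElt (gen_subproof h).

End Lie.
End Series.
Notation series X := (seq X -> rat^o).

Section Push.
Variables (X Y : finType) (phi : X -> Y).

(* Extension of [phi] to an algebra morphism of power series. *)
Definition push (f : series X) : series Y :=
  fun w => \sum_(u : (size w).-tuple X | map phi u == w) f u.

Lemma push_nil f : push f [::] = f [::].
Proof.
rewrite /push (bigD1 [tuple]) //= big1 ?addr0 // => u.
by case/andP=> _ /eqP[]; apply: tuple0.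
Qed.

Lemma push_cons f y w :
  push f (y :: w) = \sum_(x | phi x == y) push (lder x f) w.
Proof.
rewrite /push /= pair_big_dep /=.
rewrite (reindex (fun xu : X * (size w).-tuple X => [tuple of xu.1 :: xu.2])) /=.
  by apply: eq_big => // -[x u]; rewrite /= eqseq_cons.
exists (fun u : (size w).+1.-tuple X => (thead u, [tuple of behead u])).
  by move=> [x u] _; congr (_, _); apply: val_inj.
by move=> u _; rewrite [in RHS](tuple_eta u).
Qed.

Lemma push_lin c f g : push (c *: f + g) = c *: push f + push g.
Proof.
apply/funext => w; rewrite !serE /push mulr_sumr -big_split /=.
by apply: eq_bigr => u _.
Qed.
HB.instance Definition _ :=
  GRing.isLinear.Build rat (series X) (series Y) *:%R push
    (fun c f g => push_lin c f g).

Lemma push_smul f g : push (smul f g) = smul (push f) (push g).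
Proof.
apply/funext => w; elim: w f => [|y w IHw] f.
  by rewrite push_nil !smul_nil !push_nil.
rewrite smul_cons !push_cons push_nil mulr_sumr.
have -> : lder y (push f) = \sum_(x | phi x == y) push (lder x f).
  by apply/funext => v; rewrite /lder push_cons serE.
have sumL (P : pred X) (F : X -> series Y) h :
    smul (\sum_(x | P x) F x) h = \sum_(x | P x) smul (F x) h.
  apply/funext => v; rewrite serE /smul exchange_big /=.
  by apply: eq_bigr => i _; rewrite serE mulr_suml.
rewrite sumL serE -big_split /=; apply: eq_bigr => x _.
have -> : lder x (smul f g) = f [::] *: lder x g + smul (lder x f) g.
  by apply/funext => v; rewrite /lder smul_cons !serE.
by rewrite push_lin !serE IHw.
Qed.

Lemma push_letter x : push (letter x) = letter (phi x).
Proof.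
apply/funext => -[|y w]; rewrite ?push_nil ?push_cons //.
have e x' : lder x' (letter x) = fun w => ((x' == x) && (w == [::]))%:R.
  by apply/funext => v; rewrite /lder /letter eqseq_cons.
have p1 (b : bool) v : push (fun w => (b && (w == [::]))%:R) v = (b && (v == [::]))%:R.
  case: v => [|z v]; first by rewrite push_nil.
  rewrite andbF push_cons big1 // => x' _.
  by rewrite /push big1 // => u _; rewrite /lder andbF.
under eq_bigr => x' _ do rewrite e p1.
rewrite /letter eqseq_cons.
case: (eqVneq (phi x) y) => [<-|xy].
  rewrite (bigD1 x) //= !eqxx big1 ?addr0 // => x' /andP[_ /negbTE->] //.
rewrite big1 // => x' /eqP xy'.
by case: eqP xy' => // -> xy'; rewrite xy' eqxx in xy.
Qed.

Lemma push_sbr p q f g : push (sbr p q f g) = sbr p q (push f) (push g).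
Proof. by rewrite /sbr raddfB /= linearZ /= !push_smul. Qed.

Lemma push_part k f : part k (push f) = push (part k f).
Proof.
apply/funext => w; rewrite /part /push; case: eqP => wk.
  by apply: eq_bigr => u _; case: eqP => // -[]; rewrite -wk; apply: size_tuple.
rewrite big1 // => u _; case: eqP => // uk; case: wk.
by rewrite -uk; apply/esym/size_tuple.
Qed.

Variables (degX : X -> int) (degY : Y -> int).
Hypothesis deg_phi : forall x, degY (phi x) = degX x.

Lemma push_lie S k p f : lie degX S k p f -> lie degY (phi @: S) k p (push f).
Proof.
elim=> {k p f} [x xS|k p|k p c f g _ hf _ hg|k l p q f g _ hf _ hg].
- by rewrite push_letter -deg_phi; apply: lie_letter; apply: imset_f.
- by rewrite raddf0; apply: lie_zero.
- by rewrite linearP; apply: lie_lin.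
- by rewrite push_sbr; apply: lie_br.
Qed.

Lemma push_lhat S p f : lhat degX S p f -> lhat degY (phi @: S) p (push f).
Proof. by move=> hf k; rewrite push_part; apply: push_lie. Qed.

Lemma free_map_subproof p (f : free_gla degX p) :
  push (free_val f) \in free_pred degY p.
Proof.
apply/asboolP; apply: lhat_sub (push_lhat (free_lhat f)).
exact: subsetT.
Qed.

Definition free_map_fun p (f : free_gla degX p) : free_gla degY p :=
  FreeElt (free_map_subproof f).

Definition free_map : gla_mor (free_gla degX) (free_gla degY).
Proof.
apply: (@GLAMor _ _ free_map_fun).
- by move=> p c f g; apply: val_inj; apply: push_lin.
- by move=> p q r h f g; apply: val_inj; apply: push_sbr.
Defined.

Lemma free_map_gen x p (h : degX x = p) (h' : degY (phi x) = p) :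
  free_map p (gen h) = gen h'.
Proof. by apply: val_inj; apply: push_letter. Qed.
End Push.

(* The simplex [i_0 < ... < i_p] of [Delta^n] is encoded by the nonempty set
   [{i_0, ..., i_p}]; hence [p = #|s| - 1] and the generator has degree [p - 1]. *)
Definition simplex (n : nat) := {s : {set 'I_n.+1} | s != set0}.

Definition sdeg n (s : simplex n) : int := #|val s|%:Z - 2.

(* Coefficient of the generator [t] in [d s]: [i_j] is the vertex of [s] having
   exactly [j] smaller vertices in [s]. As [t] is nonempty, it vanishes when [s]
   is a vertex. *)
Definition bd_coef n (s t : simplex n) : rat :=
  \sum_(i in val s | val t == val s :\ i) (-1) ^+ #|[set j in val s | (j < i)%N]|.

Lemma cf_subproof n (i : 'I_n.+2) (s : simplex n) : lift i @: val s != set0.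
Proof.
by case: s => s /= /set0Pn[x xs]; apply/set0Pn; exists (lift i x); apply: imset_f.
Qed.

(* [lift i j] is [j] if [j < i] and [j + 1] otherwise. *)
Definition cf n (i : 'I_n.+2) (s : simplex n) : simplex n.+1 :=
  exist _ (lift i @: val s) (cf_subproof i s).

Lemma sdeg_cf n (i : 'I_n.+2) (s : simplex n) : sdeg (cf i s) = sdeg s.
Proof. by rewrite /sdeg /= card_imset //; apply: lift_inj. Qed.

Definition Lhat n : gla := free_gla (@sdeg n).

Definition coface n (i : 'I_n.+2) : gla_mor (Lhat n) (Lhat n.+1) :=
  free_map (sdeg_cf i).

Lemma vertex_subproof n (i : 'I_n.+1) : [set i] != set0.
Proof. by apply/set0Pn; exists i; rewrite inE. Qed.

Definition vertex n (i : 'I_n.+1) : simplex n := exist _ [set i] (vertex_subproof i).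

Lemma sdeg_vertex n (i : 'I_n.+1) : sdeg (vertex i) = -1.
Proof. by rewrite /sdeg /= cards1. Qed.

(* Since [simplex n] is finite, [Lhat n] is complete by construction, and continuity of
   [model_dif n] need not be required (see [dif_wlen_ge]). *)
Record compatible_models := CompatibleModels {
  model_dif : forall n, differential (Lhat n);
  model n : dgl := DGL (model_dif n);
  model_mc : forall n (i : 'I_n.+1),
    maurer_cartan (gen (sdeg_vertex i) : model n (-1));
  model_lin : forall n (s t : simplex n),
    free_val (d (erefl (sdeg s - 1)) (gen (erefl (sdeg s)) : model n (sdeg s))) [:: t]
    = bd_coef s t;
  model_coface : forall n (i : 'I_n.+2),
    dif_compat (coface i : gla_mor (model n) (model n.+1))
}.
Section Continuity.
Variables (X : finType) (deg : X -> int).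
Local Notation L := (free_gla deg).
Implicit Types f g : series X.

(* Every homogeneous Lie element of word length [k] other than 1 is a sum of
   brackets of a generator with an element of word length [k - 1]. *)
Definition leftnormed k p f := exists Y : X -> series X,
  (forall v, lie deg setT k.-1 (p - deg v) (Y v)) /\
  f = \sum_v sbr (deg v) (p - deg v) (letter v) (Y v).

Lemma leftnormed0 k p : leftnormed k p 0.
Proof.
exists (fun=> 0); split=> [v|]; first exact: lie_zero.
by rewrite big1 // => v _; rewrite raddf0.
Qed.

Lemma leftnormed_lin k p c f g :
  leftnormed k p f -> leftnormed k p g -> leftnormed k p (c *: f + g).
Proof.
move=> [Y [hY ->]] [Z [hZ ->]]; exists (fun v => c *: Y v + Z v).
split=> [v|]; first exact: lie_lin.
rewrite scaler_sumr -big_split /=; apply: eq_bigr => v _.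
by rewrite linearP.
Qed.

Lemma leftnormed_br k p f : lie deg setT k p f ->
  forall l q g, lie deg setT l q g -> leftnormed (k + l) (p + q) (sbr p q f g).
Proof.
elim=> {k p f}
  [x xS|k p|k p c f f' _ IHf _ IHf'|k k' p p' f f' hf IHf hf' IHf'] l q g hg.
- exists (fun v => if v == x then g else 0); split=> [v|].
    by case: eqP => [->|_]; [rewrite addrC addKr | apply: lie_zero].
  rewrite (bigD1 x) //= eqxx big1 ?addr0; first by rewrite [deg x + q]addrC addrK.
  by move=> v /negbTE->; rewrite raddf0.
- by rewrite -/(sbrr _ _ _ _) raddf0; apply: leftnormed0.
- by rewrite -/(sbrr _ _ _ _) linearP; apply: leftnormed_lin; [apply: IHf|apply: IHf'].
have -> : sbr (p + p') q (sbr p p' f f') g =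
    (- (-1) ^ (p * p')) *: sbr p' (p + q) f' (sbr p q f g)
    + sbr p (p' + q) f (sbr p' q f' g).
  by rewrite [sbr p (p' + q) f _]sbr_jacobi scaleNr [RHS]addrC addrK.
apply: leftnormed_lin.
  have -> : (k + k' + l = k' + (k + l))%N by lia.
  rewrite [p + p']addrC -[p' + p + q]addrA.
  by apply: IHf'; apply: lie_br.
by rewrite -addnA -addrA; apply: IHf; apply: lie_br.
Qed.

Lemma lie_leftnormed k p f : lie deg setT k p f -> k != 1%N -> leftnormed k p f.
Proof.
elim=> {k p f} // [k p _|k p c f g _ IHf _ IHg k1|k l p q f g hf _ hg _ _].
- exact: leftnormed0.
- by apply: leftnormed_lin; [apply: IHf|apply: IHg].
- exact: leftnormed_br.
Qed.

Definition wlen_ge m f := forall k, (k < m)%N -> part k f = 0.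

Lemma wlen_ge_br m n p q f g : wlen_ge m f -> wlen_ge n g -> wlen_ge (m + n) (sbr p q f g).
Proof.
move=> hf hg k kmn; rewrite part_sbr big1 // => i _.
have [im|mi] := ltnP i m.
  by rewrite hf // -/(sbrr _ _ _ _) raddf0.
by rewrite hg ?raddf0 //; have := ltn_ord i; lia.
Qed.

Lemma wlen_ge1 p f : lhat deg setT p f -> wlen_ge 1 f.
Proof. by move=> hf [|//] _; apply: lie0 (hf 0%N). Qed.

Lemma lhat_leftnormed m p f : lhat deg setT p f -> wlen_ge m.+2 f ->
  exists Z : forall v, L (p - deg v),
    (forall v, wlen_ge m.+1 (free_val (Z v))) /\
    f = \sum_v sbr (deg v) (p - deg v) (letter v) (free_val (Z v)).
Proof.
move=> hf Ff.
have /choice[Y hY] : forall k, exists Y : X -> series X,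
    (forall v, lie deg setT k.-1 (p - deg v) (Y v)) /\
    part k f = \sum_v sbr (deg v) (p - deg v) (letter v) (Y v).
  move=> k; have [->|k1] := eqVneq k 1%N; last exact: lie_leftnormed.
  by rewrite (Ff 1%N) //; apply: leftnormed0.
pose Z v : series X := fun w => if (size w <= m)%N then 0 else Y (size w).+1 v w.
have ZP v k : part k (Z v) = if (k <= m)%N then 0 else Y k.+1 v.
  apply/funext => w; rewrite /part /Z; case: eqP => [->|kw]; first by case: ifP.
  case: ifP => // _; have [/(_ v) /lie_part <- _] := hY k.+1.
  by rewrite /part /=; case: eqP.
have Zl v : Z v \in free_pred deg (p - deg v).
  apply/asboolP => k; rewrite ZP; case: ifP => _; first exact: lie_zero.
  by have [] := hY k.+1.
exists (fun v => FreeElt (Zl v)); split=> [v k|/=].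
  by rewrite ltnS /= ZP => ->.
apply/funext => w.
have pw (g : series X) : g w = part (size w) g w by rewrite /part eqxx.
have Fl v : wlen_ge 1 (letter v) by apply: wlen_ge1 (lhat_letter _ _); rewrite inE.
have FZ v : wlen_ge m.+1 (Z v) by move=> k; rewrite ltnS ZP => ->.
rewrite pw [RHS]pw [in RHS]raddf_sum /=; congr (_ w).
have [wm|mw] := leqP (size w) m.+1.
  by rewrite Ff // big1 // => v _; apply: (@wlen_ge_br 1 m.+1 _ _ _ _ (Fl v) (FZ v)).
have [_ ->] := hY (size w); apply: eq_bigr => v _.
have w1 : (1 < (size w).+1)%N by lia.
rewrite part_sbr (bigD1 (Ordinal w1)) //= big1 ?addr0.
  rewrite (lie_part (lie_letter deg (in_setT v))) ZP ifN; last by lia.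
  by congr (sbr _ _ _ (Y _ _)); lia.
move=> i i1; rewrite -(lie_part (lie_letter deg (in_setT v))) part_part ifN.
  by rewrite -/(sbrr _ _ _ _) raddf0.
by apply: contra i1 => /eqP e; apply/eqP/val_inj.
Qed.

Lemma free_val_sum p (I : Type) (r : seq I) (P : pred I) (x : I -> L p) :
  free_val (\sum_(i <- r | P i) x i) = \sum_(i <- r | P i) free_val (x i).
Proof. exact: (raddf_sum (val : free_elt deg p -> series X)). Qed.

Lemma free_val_lin p c (x y : L p) :
  free_val (c *: x + y) = c *: free_val x + free_val y.
Proof. by []. Qed.

Variable D : differential L.

Lemma dif_wlen_ge m p q (h : p - 1 = q) (x : L p) :
  wlen_ge m (free_val x) -> wlen_ge m (free_val (dif D h x)).
Proof.
elim: m p q h x => [|[|m] IHm] p q h x Fx //; first exact/wlen_ge1/free_lhat.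
have [Z [FZ xZ]] := lhat_leftnormed (free_lhat x) Fx.
have hd v : deg v + (p - deg v) = p by rewrite addrC subrK.
have -> : x = \sum_v br (hd v) (gen (erefl (deg v))) (Z v).
  by apply: val_inj; rewrite /= xZ free_val_sum.
rewrite raddf_sum => k km; rewrite free_val_sum raddf_sum big1 // => v _.
have h1 : deg v - 1 + (p - deg v) = q by rewrite -h -[in RHS](hd v) addrAC.
have h2 : deg v + (p - deg v - 1) = q by rewrite -h -[in RHS](hd v) addrA.
rewrite [X in free_val X](dif_br D (hd v) erefl erefl h h1 h2) addrC free_val_lin.
rewrite [LHS]part_lin /=.
have F1g : wlen_ge 1 (letter v) by apply: (@wlen_ge1 (deg v)); apply: lhat_letter; rewrite inE.
have F1d : wlen_ge 1 (free_val (dif D (erefl (deg v - 1)) (gen (erefl (deg v))))).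
  exact/wlen_ge1/free_lhat.
rewrite (@wlen_ge_br 1 m.+1 _ _ _ _ F1g (IHm _ _ _ _ (FZ v))) // scaler0 add0r.
exact: (@wlen_ge_br 1 m.+1 _ _ _ _ F1d (FZ v)).
Qed.

(* If [D] maps every generator in [S] to the free complete graded Lie algebra on
   [S], then it preserves the latter. *)
Section Stable.
Variable S : {set X}.
Hypothesis DS : forall x, x \in S -> forall q (h : deg x - 1 = q),
  lhat deg S q (free_val (dif D h (gen (erefl (deg x))))).

Lemma lie_free k p f : lie deg S k p f -> f \in free_pred deg p.
Proof.
by move=> hf; apply/asboolP; apply: lhat_sub (lie_lhat hf); apply: subsetT.
Qed.

Lemma dif_lie k p f : lie deg S k p f -> forall q (h : p - 1 = q) (x : L p),
  free_val x = f -> lhat deg S q (free_val (dif D h x)).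
Proof.
elim=> {k p f}
  [x xS|k p|k p c f g hf IHf hg IHg|k l p p' f g hf IHf hg IHg] q h y yf.
- have -> : y = gen (erefl (deg x)) by apply: val_inj.
  exact: DS.
- have -> : y = 0 by apply: val_inj.
  by rewrite raddf0; apply: lhat0.
- have -> : y = c *: (FreeElt (lie_free hf) : L p) + (FreeElt (lie_free hg) : L p).
    by apply: val_inj.
  by rewrite linearP; apply: lhat_lin; [apply: IHf|apply: IHg].
have -> : y = br (erefl (p + p'))
    (FreeElt (lie_free hf) : L p) (FreeElt (lie_free hg) : L p').
  by apply: val_inj.
have h1 : p - 1 + p' = q by rewrite -h addrAC.
have h2 : p + (p' - 1) = q by rewrite -h addrA.
rewrite (dif_br D _ erefl erefl h h1 h2) addrC free_val_lin.
have brS a b r (e : a + b = r) u v : lhat deg S a u -> lhat deg S b v ->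
    lhat deg S r (sbr a b u v) by rewrite -e; apply: lhat_br.
apply: lhat_lin; [apply: (brS _ _ _ h2)|apply: (brS _ _ _ h1)].
- exact: lie_lhat hf.
- exact: IHg.
- exact: IHf.
- exact: lie_lhat hg.
Qed.

Lemma dif_lhat p q (h : p - 1 = q) (x : L p) :
  lhat deg S p (free_val x) -> lhat deg S q (free_val (dif D h x)).
Proof.
move=> hx k.
pose X' : L p := \sum_(j < k.+1) (FreeElt (lie_free (hx j)) : L p).
have -> : x = X' + (x - X') by rewrite addrC subrK.
have -> : dif D h (X' + (x - X')) = 1 *: dif D h X' + dif D h (x - X').
  by rewrite raddfD scale1r.
rewrite free_val_lin part_lin.
rewrite [part k (free_val (dif D h (x - X')))](@dif_wlen_ge k.+1) ?addr0 //.
  apply: lieZ; rewrite raddf_sum free_val_sum raddf_sum; apply: lie_sum => j _.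
  exact: (dif_lie (hx j)).
move=> i ik; rewrite -scaleN1r addrC free_val_lin part_lin scaleN1r.
rewrite free_val_sum raddf_sum (bigD1 (Ordinal ik)) //= part_part eqxx.
rewrite big1 ?addr0 ?addNr // => j ji; rewrite part_part ifN //.
by apply: contra ji => /eqP e; apply/eqP/val_inj.
Qed.
End Stable.
End Continuity.

Section Model.
Variable M : compatible_models.

Definition faces n (s : simplex n) : {set simplex n} := [set t : simplex n | val t \subset val s].

Lemma model_faces n (s : simplex n) q (h : sdeg s - 1 = q) :
  lhat (@sdeg n) (faces s) q
    (free_val (dif (model_dif M n) h (gen (erefl (sdeg s))))).
Proof.
elim: n => [|n IHn] in s q h *.
  have -> : faces s = setT.
    apply/setP => t; rewrite !inE; apply/subsetP => i _.
    by case/set0Pn: (valP s) => j; rewrite !ord1.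
  exact: free_lhat.
have [fs|] := eqVneq (val s) setT.
  have -> : faces s = setT by apply/setP => t; rewrite !inE fs subsetT.
  exact: free_lhat.
rewrite -subTset => /subsetPn[i _ is_].
pose t0 := lift i @^-1: val s.
have t0s : lift i @: t0 = val s.
  apply/setP => j; apply/imsetP/idP => [[k]|js].
    by rewrite inE => ks ->.
  have [k jk|ji] := unliftP i j; last by rewrite ji (negbTE is_) in js.
  by exists k => //; rewrite inE -jk.
have t00 : t0 != set0.
  by apply: contraNneq (valP s) => e; rewrite -t0s e imset0.
pose t : simplex n := exist _ t0 t00.
have st : s = cf i t by apply: val_inj.
have ht : sdeg t - 1 = q by rewrite -h st sdeg_cf.
have hts : sdeg s = sdeg t by rewrite st sdeg_cf.
have {h} -> : dif (model_dif M n.+1) h (gen (erefl (sdeg s)))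
    = dif (model_dif M n.+1) ht (gen hts).
  by case: _ / hts ht => ht; congr dif; apply: eq_irrelevance.
have -> : gen hts = coface i (sdeg t) (gen (erefl (sdeg t))).
  by apply: val_inj; rewrite /= push_letter st.
have -> : dif (model_dif M n.+1) ht (coface i (sdeg t) (gen (erefl (sdeg t))))
    = coface i q (dif (model_dif M n) ht (gen (erefl (sdeg t)))).
  by apply: esym; apply: (@model_coface M n i _ _ ht).
apply: lhat_sub (push_lhat (sdeg_cf i) (IHn t q ht)).
apply/subsetP => _ /imsetP[u us ->]; move: us; rewrite !inE /= -t0s.
exact: imsetS.
Qed.

Record scomplex (T : finType) := SComplex {
  simplices : {set {set T}};
  simplices_neq0 : set0 \notin simplices;
  simplices_face : forall s t : {set T},
    s \in simplices -> t \subset s -> t != set0 -> t \in simplices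
}.

Lemma component_subproof (T : finType) (K : scomplex T) (a : T) :
  let S := [set s in simplices K |
    s \subset [set x | connect (fun y z => [set y; z] \in simplices K) a x]] in
  (set0 \notin S) /\
  (forall s t : {set T}, s \in S -> t \subset s -> t != set0 -> t \in S).
Proof.
split=> [|s t]; first by rewrite inE (negbTE (simplices_neq0 K)).
rewrite !inE => /andP[sK sa] ts t0.
by rewrite (simplices_face sK ts t0) (subset_trans ts sa).
Qed.

(* The simplices of [K] all of whose vertices are joined to [a] by an edge path. *)
Definition component (T : finType) (K : scomplex T) (a : T) : scomplex T :=
  SComplex (component_subproof K a).1 (component_subproof K a).2.

Lemma embed_subproof (T U : finType) (f : T -> U) (K : scomplex T) :
  let S := [set f @: (s : {set T}) | s in simplices K] in
  (set0 \notin S) /\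
  (forall s t : {set U}, s \in S -> t \subset s -> t != set0 -> t \in S).
Proof.
split=> [|_ t /imsetP[s sK ->] ts t0].
  apply/imsetP => -[s sK /esym/eqP]; rewrite imset_eq0 => /eqP s0.
  by rewrite s0 (negbTE (simplices_neq0 K)) in sK.
have tE : t = f @: (s :&: f @^-1: t).
  apply/setP => y; apply/idP/imsetP => [yt|[x]].
    have /imsetP[x xs yx] := subsetP ts y yt.
    by exists x => //; rewrite !inE xs -yx yt.
  by rewrite !inE => /andP[_ xt] ->.
rewrite tE; apply: imset_f; apply: (simplices_face sK); first exact: subsetIl.
by apply: contraNneq t0 => e; rewrite tE e imset0.
Qed.

(* The image of [K] under a map of vertices; used with [f] injective on the
   vertices of [K], when it is a copy of [K]. *)
Definition embed (T U : finType) (f : T -> U) (K : scomplex T) : scomplex U :=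
  SComplex (embed_subproof f K).1 (embed_subproof f K).2.

Definition simplex_set n (K : scomplex 'I_n.+1) : {set simplex n} :=
  [set t : simplex n | val t \in simplices K].

Section SubModel.
Variables (n : nat) (K : scomplex 'I_n.+1).

Definition submodel_pred p : {pred model M n p} :=
  fun x => `[< lhat (@sdeg n) (simplex_set K) p (free_val x) >].

Lemma submodel_submod p : submod_closed (@submodel_pred p).
Proof.
split=> [|c x y]; first by apply/asboolP/lhat0.
by move=> /asboolP hx /asboolP hy; apply/asboolP/lhat_lin.
Qed.

Lemma submodel_br (p q r : int) (h : p + q = r) x y :
  x \in @submodel_pred p -> y \in @submodel_pred q -> br h x y \in @submodel_pred r.
Proof.
move=> /asboolP hx /asboolP hy; apply/asboolP => /=.
by rewrite -[X in lhat _ _ X]h; apply: lhat_br.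
Qed.

Lemma submodel_d (p q : int) (h : p - 1 = q) x :
  x \in @submodel_pred p -> d h x \in @submodel_pred q.
Proof.
move=> /asboolP hx; apply/asboolP; apply: dif_lhat hx => s sK r hr.
apply: lhat_sub (model_faces hr); apply/subsetP => t; rewrite !inE => ts.
by rewrite inE in sK; apply: simplices_face sK ts (valP t).
Qed.

Definition submodel : subdgl (model M n) :=
  SubDGL submodel_submod submodel_br submodel_d.
End SubModel.

Section LieModel.
Variables (T : finType) (n : nat) (f : T -> 'I_n.+1).

Definition lie_model (K : scomplex T) : dgl := subdgl_dgl (submodel (embed f K)).

Lemma lie_model_vertex_subproof (K : scomplex T) a : [set a] \in simplices K ->
  (gen (sdeg_vertex (f a)) : model M n (-1)) \in @submodel_pred n (embed f K) (-1).
Proof.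
move=> aK; apply/asboolP; rewrite -[X in lhat _ _ X](sdeg_vertex (f a)).
apply: lhat_letter; rewrite inE /=; apply/imsetP; exists [set a] => //.
by rewrite imset_set1.
Qed.

Definition lie_model_vertex (K : scomplex T) a (aK : [set a] \in simplices K) :
  lie_model K (-1) :=
  @SubdglElt _ (submodel (embed f K)) _ _ (lie_model_vertex_subproof aK).

Lemma lie_model_mc (K : scomplex T) a (aK : [set a] \in simplices K) :
  maurer_cartan (lie_model_vertex aK).
Proof. by apply: val_inj; apply: model_mc. Qed.

Definition twisted_model (K : scomplex T) a (aK : [set a] \in simplices K) : dgl :=
  twist (lie_model_mc aK).

Variables (K : scomplex T) (a : T) (aK : [set a] \in simplices K).

Lemma component_vertex : [set a] \in simplices (component K a).
Proof. by rewrite inE aK sub1set inE; apply: connect0. Qed.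

Lemma component_incl_subproof p :
  {subset @submodel_pred n (embed f (component K a)) p
    <= @submodel_pred n (embed f K) p}.
Proof.
move=> x /asboolP hx; apply/asboolP; apply: lhat_sub hx.
apply/subsetP => s; rewrite !inE => /imsetP[t]; rewrite inE => /andP[tK _] ->.
exact: imset_f.
Qed.

Definition lie_model_incl : dgl_mor (lie_model (component K a)) (lie_model K) :=
  @incl _ (submodel (embed f (component K a))) (submodel (embed f K))
    component_incl_subproof.

Lemma lie_model_incl_vertex :
  lie_model_incl (-1) (lie_model_vertex component_vertex) = lie_model_vertex aK.
Proof. exact: val_inj. Qed.

Definition component_incl :
    dgl_mor (twisted_model component_vertex) (twisted_model aK) :=
  twist_mor (lie_model_mc component_vertex) (lie_model_mc aK)
    lie_model_incl_vertex.
End LieModel.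
End Model.

(* Main.v *)
Require Import Defs.
From mathcomp Require Import all_boot all_order all_algebra.
From mathcomp Require Import boolp functions.
From mathcomp Require Import ring zify.

Set Implicit Arguments.
Unset Strict Implicit.
Unset Printing Implicit Defensive.

Import GRing.Theory.
Local Open Scope ring_scope.
Local Open Scope quotient_scope.

(** Let [S] be the set of generators of the model of [K], [A] the subset of those
    coming from the component of [a], and [D] the differential twisted by [a].
    The inclusion is injective, so it suffices that every [x] over [S] with [D x]
    over [A] becomes a Lie series over [A] after subtracting some [D y]
    ([quasi_iso_relative], [relative_acyclic]). As no simplex of the component has
    a face in common with a simplex outside of it, the restriction of series to the
    words in [A] commutes with [D], and what has to be shown is: a cycle [x] all of
    whose words contain an outer letter, that is, a letter outside [A], is a boundary.

    Everything is computed in the algebra of series, where [D] extends to a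
    derivation ([dif_sder]) and operators can be compared on words ([cont_ext]).
    Give weight 1 to the letters of [A] and weight 2 to the outer ones. The part of
    [D] raising the weight by at most 1 is the derivation [delta1] given by the linear
    and quadratic parts of [D] on [A], and by [b |-> d b + [a, b]] on an outer [b].

    On series, [delta1] is contracted by [strip], which deletes the letter in front
    of the first outer letter when that letter is a vertex of [A], and kills the
    word otherwise ([strip_homotopy]). It undoes [b |-> [a, b]], and it undoes the
    quadratic part [q] of the differential on [A], because summation over the
    vertices is a counit for [q]: the sum over the vertices [t] of the coefficients
    of [s t] in [q v] is the sign of the degree of [v] if [s = v], and 0 otherwise ([cocomp_neq],
    [cocomp_diag]). Indeed a term [s t] of [q v] has [s] a face of [v] of the
    same dimension as [v], hence [s = v]; the remaining coefficient changes sign with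
    the dimension since the square of the differential vanishes, and it is [-1] on
    vertices by the Maurer-Cartan equation.

    As [strip] does not preserve Lie series, it is followed by a relative version
    [rho] of the Dynkin operator: a word goes to its right-nested bracket if it ends
    in an outer letter, and to 0 otherwise. On Lie series [rho] multiplies the
    coefficient of a word by its number of outer letters ([rho_lie]), and it commutes with
    [delta1] ([rho_sder]). Dividing by the number of outer letters, which is possible
    in characteristic 0, yields an operator [Theta] on Lie series with
    [Theta delta1 + delta1 Theta = id] where every word has an outer letter. Replacing
    [x] by [x - D (Theta x)] therefore raises its weight ([Theta_step]); iterating,
    [x] is the boundary of a series that converges word by word ([acyclic_out]). *)

(** * Series and continuous operators *)

Local Notation sg k := ((-1) ^ (k : int) : rat).

Lemma sgB1 k : sg (k - 1) = - sg k.
Proof. by rewrite sgnD mulrN1. Qed.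

Lemma sgN k : sg (- k) = sg k.
Proof.
have k0 : sg k != 0 by apply/eqP => k0; have := sgn_sq k; rewrite k0 mul0r.
by apply: (mulIf k0); rewrite -sgnD addNr sgn_sq.
Qed.

Lemma sgN1 : sg (-1) = -1.
Proof. by rewrite sgN. Qed.

Section Series.
Variable X : finType.
Implicit Types (f g h : series X) (u v w : seq X) (T : series X -> series X).

Definition monom u : series X := fun w => (w == u)%:R.

Definition supp (P : seq X -> Prop) f := forall w, f w != 0 -> P w.

Definition low n f := forall w, (size w < n)%N -> f w = 0.

Lemma supp_sub (P Q : seq X -> Prop) f : (forall w, P w -> Q w) -> supp P f -> supp Q f.
Proof. by move=> PQ Pf w /Pf /PQ. Qed.

Lemma supp_lin P c f g : supp P f -> supp P g -> supp P (c *: f + g).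
Proof.
move=> Pf Pg w; rewrite serD serZ.
have [->|/Pf //] := eqVneq (f w) 0; rewrite mulr0 add0r; exact: Pg.
Qed.

Lemma supp_smul (P Q R : seq X -> Prop) f g :
  (forall u v, P u -> Q v -> R (u ++ v)) -> supp P f -> supp Q g -> supp R (smul f g).
Proof.
move=> PQR Pf Qg w; apply: contra_neqP => Rw.
rewrite /smul big1 // => i _.
have [->|/Pf Pu] := eqVneq (f (take i w)) 0; first by rewrite mul0r.
have [->|/Qg Qv] := eqVneq (g (drop i w)) 0; first by rewrite mulr0.
by case: Rw; rewrite -(cat_take_drop i w); apply: PQR.
Qed.

Lemma smul0l f : smul 0 f = 0.
Proof. by apply/funext => w; rewrite /smul big1 // => i _; rewrite mul0r. Qed.

Lemma smulZl c f g : smul (c *: f) g = c *: smul f g.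
Proof. by rewrite -[c *: f]addr0 smulPl smul0l addr0. Qed.

Lemma smulDl f f' g : smul (f + f') g = smul f g + smul f' g.
Proof. by rewrite -[f]scale1r smulPl !scale1r. Qed.

Lemma smul1l f : smul (monom [::]) f = f.
Proof.
apply/funext => -[|x w]; first by rewrite smul_nil mul1r.
by rewrite smul_cons mul1r (_ : lder x _ = 0) ?smul0l ?addr0 //; apply/funext.
Qed.

Lemma lder_letter x y f : lder y (smul (letter x) f) = (y == x)%:R *: f.
Proof.
apply/funext => w; rewrite /lder serZ smul_cons mul0r add0r.
have -> : lder y (letter x) = (y == x)%:R *: monom [::].
  by apply/funext => v; rewrite /lder /letter /monom eqseq_cons serZ -natrM mulnb.
by rewrite smulZl smul1l.
Qed.

Lemma smul_letter x f y w : smul (letter x) f (y :: w) = (y == x)%:R * f w.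
Proof. by rewrite -[LHS]/(lder y _ w) lder_letter. Qed.

Lemma monom_cons x u : monom (x :: u) = smul (letter x) (monom u).
Proof.
apply/funext => -[|y w]; first by rewrite smul_nil mul0r.
by rewrite smul_letter /monom eqseq_cons -natrM mulnb.
Qed.

(** Linear and continuous for the word-length topology. *)
Definition cont T := linear T /\
  forall k, exists n, forall f, low n f -> low k (T f).

Lemma cont0 T : cont T -> T 0 = 0.
Proof. by case=> lT _; have := lT (-1) 0 0; rewrite !(scaleN1r, addNr). Qed.

Lemma contP T c f g : cont T -> T (c *: f + g) = c *: T f + T g.
Proof. by move=> [lT _]; apply: lT. Qed.

Lemma contD T f g : cont T -> T (f + g) = T f + T g.
Proof. by move=> cT; rewrite -[f]scale1r contP ?scale1r. Qed.

Lemma contZ T c f : cont T -> T (c *: f) = c *: T f.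
Proof. by move=> cT; rewrite -[c *: f]addr0 contP // cont0 // addr0. Qed.

Lemma cont_sum T (I : Type) (r : seq I) (P : pred I) (F : I -> series X) : cont T ->
  T (\sum_(i <- r | P i) F i) = \sum_(i <- r | P i) T (F i).
Proof. by move=> cT; apply: big_morph => [f g|]; [apply: contD|apply: cont0]. Qed.

Lemma cont_id : cont id.
Proof. by split=> [c f g //|k]; exists k. Qed.

Lemma cont_comp T T' : cont T -> cont T' -> cont (fun f => T (T' f)).
Proof.
move=> cT cT'; split=> [c f g|k]; first by rewrite /= (contP _ _ _ cT') (contP _ _ _ cT).
have [n hn] := cT.2 k; have [m hm] := cT'.2 n.
by exists m => f /hm /hn.
Qed.

Lemma cont_lin c T T' : cont T -> cont T' -> cont (fun f => c *: T f + T' f).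
Proof.
move=> cT cT'; split=> [b f g|k].
  by rewrite /= (contP _ _ _ cT) (contP _ _ _ cT') !scalerDr !scalerA [c * b]mulrC addrACA.
have [n hn] := cT.2 k; have [m hm] := cT'.2 k.
exists (maxn n m) => f lf w wk; rewrite serD serZ hn // ?hm // ?mulr0 ?addr0 // => v vn;
  by apply: lf; rewrite (leq_trans vn) // ?leq_maxl ?leq_maxr.
Qed.

Lemma cont_zero : cont (fun=> 0).
Proof. by split=> [c f g|k]; [rewrite scaler0 addr0 | exists 0%N]. Qed.

Lemma cont_scale c T : cont T -> cont (fun f => c *: T f).
Proof.
move=> cT; have := cont_lin c cT cont_zero.
by congr cont; apply/funext => f; rewrite addr0.
Qed.

Lemma cont_add T T' : cont T -> cont T' -> cont (fun f => T f + T' f).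
Proof.
move=> cT cT'; have := cont_lin 1 cT cT'.
by congr cont; apply/funext => f; rewrite scale1r.
Qed.

Lemma cont_opp T : cont T -> cont (fun f => - T f).
Proof. by move=> /(cont_scale (-1)); congr cont; apply/funext => f; rewrite scaleN1r. Qed.

Lemma cont_smull (u : series X) : cont (smul u).
Proof.
split=> [c f g|k]; first exact: smulPr.
exists k => f lf w wk; rewrite /smul big1 // => i _.
by rewrite [f _]lf ?mulr0 // size_drop; lia.
Qed.

Lemma cont_smulr (u : series X) : cont (fun f => smul f u).
Proof.
split=> [c f g|k]; first exact: smulPl.
exists k => f lf w wk; rewrite /smul big1 // => i _.
by rewrite [f _]lf ?mul0r // size_take; case: ifP; lia.
Qed.

Definition local T := forall k f, low k f -> low k (T f).

Lemma cont_local T : linear T -> local T -> cont T.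
Proof. by move=> lT hT; split=> // k; exists k => f; apply: hT. Qed.

Definition trunc n f : series X := \sum_(k < n) \sum_(u : k.-tuple X) f u *: monom u.

Lemma truncE n f w : trunc n f w = if (size w < n)%N then f w else 0.
Proof.
rewrite /trunc ser_sum; under eq_bigr => k _ do rewrite ser_sum.
case: ifP => [wn|/negbT wn].
  rewrite (bigD1 (Ordinal wn)) //= (bigD1 (in_tuple w)) //= serZ /monom eqxx mulr1.
  rewrite !big1 ?addr0 // => [k kw|u uw].
    rewrite big1 // => u _; rewrite serZ /monom; case: eqP => [wu|_]; last by rewrite mulr0.
    by case/eqP: kw; apply: val_inj; rewrite /= wu size_tuple.
  rewrite serZ /monom; case: eqP => [wu|_]; last by rewrite mulr0.
  by case/eqP: uw; apply: val_inj.
rewrite big1 // => k _; rewrite big1 // => u _.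
rewrite serZ /monom; case: eqP => [wu|_]; last by rewrite mulr0.
by case/negP: wn; rewrite wu size_tuple.
Qed.

Lemma low_trunc n f : low n (f - trunc n f).
Proof. by move=> w wn; rewrite serD serN truncE wn subrr. Qed.

(** Both sides are determined by their values on monomials, which makes monomial
    computations sufficient for identities between operators on infinite series. *)
Lemma cont_ext (P : seq X -> Prop) T T' f : cont T -> cont T' ->
  (forall u, P u -> T (monom u) = T' (monom u)) -> supp P f -> T f = T' f.
Proof.
move=> cT cT' TT' Pf; apply/funext => w.
have [n hn] := cT.2 (size w).+1; have [m hm] := cT'.2 (size w).+1.
pose N := maxn n m.
have lN : low N (f - trunc N f) by apply: low_trunc.
have lw k : (k <= N)%N -> low k (f - trunc N f).
  by move=> kN v vk; apply: lN; apply: leq_trans vk kN.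
rewrite -[f](subrK (trunc N f)) (contD _ _ cT) (contD _ _ cT') !serD.
rewrite [T (f - _) w]hn ?[T' (f - _) w]hm //; last 2 first.
- by apply: lw; rewrite leq_maxr.
- by apply: lw; rewrite leq_maxl.
congr (_ + _ w); rewrite /trunc !cont_sum //; apply: eq_bigr => k _.
rewrite !cont_sum //; apply: eq_bigr => u _; rewrite !contZ //.
by have [->|/Pf/TT'->//] := eqVneq (f u) 0; rewrite !scale0r.
Qed.

End Series.

(** * Derivations of the algebra of series *)

Section Graded.
Variables (X : finType) (deg : X -> int).
Implicit Types (f g h : series X) (u v w : seq X) (T : series X -> series X).
Implicit Types (F G : X -> series X).

Definition wdeg w : int := \sum_(x <- w) deg x.

Lemma wdeg_nil : wdeg [::] = 0.
Proof. exact: big_nil. Qed.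

Lemma wdeg_cons x w : wdeg (x :: w) = deg x + wdeg w.
Proof. exact: big_cons. Qed.

Lemma wdeg_cat u v : wdeg (u ++ v) = wdeg u + wdeg v.
Proof. exact: big_cat. Qed.

Definition homog p f := supp (fun w => wdeg w = p) f.

Lemma homog_monom u : homog (wdeg u) (monom u).
Proof. by move=> w; rewrite /monom; case: (eqVneq w u) => [->|]; rewrite ?eqxx. Qed.

Lemma homog_letter x : homog (deg x) (letter x).
Proof.
by move: (@homog_monom [:: x]); rewrite /homog wdeg_cons wdeg_nil addr0.
Qed.

Lemma homog_smul p q f g : homog p f -> homog q g -> homog (p + q) (smul f g).
Proof. by apply: supp_smul => u v <- <-; rewrite wdeg_cat. Qed.

(** The derivation with value [F x] on the letter [x], obtained by applying the
    Leibniz rule to [f = f [::] + \sum_x x (lder x f)]. *)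
Fixpoint sder F f w : rat :=
  \sum_x smul (F x) (lder x f) w
  + (if w is y :: v then sg (deg y) * sder F (lder y f) v else 0).

Lemma sder_lin F : linear (sder F : series X -> series X).
Proof.
move=> c f g; apply/funext => w; rewrite serD serZ.
elim: w f g => [|y w IHw] f g /=.
  rewrite !addr0 mulr_sumr -big_split; apply: eq_bigr => x _.
  by rewrite -[lder x _]/(c *: lder x f + lder x g) smulPr !serE.
rewrite -[lder y _]/(c *: lder y f + lder y g) IHw.
under eq_bigr => x _ do
  rewrite -[lder x _]/(c *: lder x f + lder x g) smulPr serD serZ.
by rewrite big_split /= -mulr_sumr; ring.
Qed.

Definition nounit f := f [::] = 0.

Lemma sder_local F : (forall x, nounit (F x)) -> local (sder F).
Proof.
move=> F0 k f lf w; elim: w k f lf => [|y w IHw] k f lf wk /=.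
  by rewrite addr0 big1 // => x _; rewrite smul_nil F0 mul0r.
rewrite (IHw k.-1) ?mulr0 ?addr0; last first.
- by move: wk => /=; lia.
- by move=> v vk; rewrite /lder lf //=; move: vk; lia.
rewrite big1 // => x _; rewrite /smul big1 // => -[[|i] ik] _ /=.
  by rewrite F0 mul0r.
rewrite [lder _ _ _]lf ?mulr0 //= size_drop; move: wk => /=; lia.
Qed.

Lemma sder_cont F : (forall x, nounit (F x)) -> cont (sder F).
Proof. by move=> F0; apply: cont_local (sder_lin F) (sder_local F0). Qed.

Lemma sder0 F : sder F 0 = 0.
Proof. by have := sder_lin F (-1) 0 0; rewrite !(scaleN1r, addNr). Qed.

Lemma sder_letterl F x f :
  sder F (smul (letter x) f)
  = smul (F x) f + sg (deg x) *: smul (letter x) (sder F f).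
Proof.
apply/funext => w; rewrite serD serZ.
have e : \sum_y smul (F y) (lder y (smul (letter x) f)) w = smul (F x) f w.
  rewrite (bigD1 x) //= lder_letter eqxx scale1r big1 ?addr0 // => y /negbTE yx.
  by rewrite lder_letter yx scale0r raddf0.
case: w e => [|y w] /= ->; first by rewrite (smul_nil (letter x)) mul0r mulr0.
rewrite lder_letter smul_letter; case: eqVneq => [->|_].
  by rewrite scale1r mul1r.
by rewrite scale0r sder0 mul0r !mulr0.
Qed.

Lemma sder_nil F : sder F (monom [::]) = 0.
Proof.
apply/funext => w; have l0 x : lder x (monom [::]) = 0 by apply/funext.
case: w => [|y w] /=; rewrite ?l0 ?sder0 ?mulr0 addr0 big1 // => x _;
  by rewrite l0 raddf0.
Qed.

Lemma sder_letter F x : sder F (letter x) = F x.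
Proof.
rewrite -[letter x]/(monom [:: x]) monom_cons sder_letterl sder_nil raddf0 scaler0.
rewrite addr0; apply/funext => w.
elim: w (F x) => [|y w IHw] f; first by rewrite smul_nil mulr1.
by rewrite smul_cons mulr0 add0r IHw.
Qed.

Lemma sder_smul F p f g : (forall x, nounit (F x)) -> homog p f ->
  sder F (smul f g) = smul (sder F f) g + sg p *: smul f (sder F g).
Proof.
move=> F0 hf; have cF := sder_cont F0.
apply: (@cont_ext _ _ (fun f => sder F (smul f g))
  (fun f => smul (sder F f) g + sg p *: smul f (sder F g)) f _ _ _ hf).
- exact: cont_comp cF (cont_smulr g).
- apply: cont_add; first exact: cont_comp (cont_smulr g) cF.
  exact: cont_scale (cont_smulr _).
move=> {hf} u <- {p}; elim: u => [|x u IHu].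
  by rewrite wdeg_nil smul1l sder_nil smul0l add0r smul1l scale1r.
rewrite wdeg_cons sgnD monom_cons -!smulA !sder_letterl IHu.
rewrite smulDl smulZl -!smulA raddfD /= scalerDr addrA.
by rewrite linearZ /= scalerA.
Qed.

(** A derivation replaces one letter of a word by a word of its value; degrees,
    weights and alphabets are all tracked through this description. *)
Lemma supp_sder (P Q : seq X -> Prop) F f :
  (forall u x v s, P (u ++ x :: v) -> F x s != 0 -> Q (u ++ s ++ v)) ->
  supp P f -> supp Q (sder F f).
Proof.
move=> PQ Pf w; elim: w P Q PQ f Pf => [|y w IHw] P Q PQ f Pf; apply: contra_neqP => Qw /=.
  rewrite addr0 big1 // => x _; rewrite smul_nil.
  have [->|Fs] := eqVneq (F x [::]) 0; first by rewrite mul0r.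
  have [->|/Pf fs] := eqVneq (lder x f [::]) 0; first by rewrite mulr0.
  by case: Qw; apply: (PQ [::] x [::] [::]).
rewrite big1 => [|x _]; last first.
  rewrite /smul big1 // => i _.
  have [->|Fs] := eqVneq (F x (take i (y :: w))) 0; first by rewrite mul0r.
  have [->|/Pf fs] := eqVneq (lder x f (drop i (y :: w))) 0; first by rewrite mulr0.
  case: Qw; rewrite -[y :: w](cat_take_drop i).
  by have := PQ [::] x _ _ fs Fs.
rewrite add0r; have [->|/IHw] := eqVneq (sder F (lder y f) w) 0; first by rewrite mulr0.
move=> /(_ (P \o cons y) (Q \o cons y)) /= Qyw; case: Qw; apply: Qyw => [u x v s|v /Pf //].
exact: (PQ (y :: u)).
Qed.

Definition lowers F := forall x, homog (deg x - 1) (F x).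

Lemma homog_sder F p f : lowers F -> homog p f -> homog (p - 1) (sder F f).
Proof.
move=> Fh; apply: supp_sder => u x v s; rewrite !wdeg_cat wdeg_cons => <- /Fh ->; ring.
Qed.

Lemma sderB F G f : sder (fun x => F x - G x) f = sder F f - sder G f.
Proof.
apply/funext => w; rewrite serD serN; elim: w f => [|y w IHw] f /=.
  rewrite !addr0 -sumrB; apply: eq_bigr => x _.
  by rewrite smulDl -scaleN1r smulZl !serE; ring.
rewrite IHw opprD addrACA -mulrBr; congr (_ + _).
rewrite -sumrB; apply: eq_bigr => x _.
by rewrite smulDl -scaleN1r smulZl !serE; ring.
Qed.

Lemma sder_sbr F p q f g : (forall x, nounit (F x)) -> homog p f -> homog q g ->
  sder F (sbr p q f g)
  = sbr (p - 1) q (sder F f) g + sg p *: sbr p (q - 1) f (sder F g).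
Proof.
move=> F0 hf hg; have cF := sder_cont F0.
rewrite /sbr (contD _ _ cF) -scaleNr (contZ _ _ cF).
rewrite (sder_smul _ F0 hf) (sder_smul _ F0 hg).
rewrite mulrBl mul1r mulrBr mulr1 !sgnD !sgN; set s := sg (p * q).
have pp : sg p * sg p = 1 by exact: sgn_sq.
apply/funext => w; rewrite !serE; ring: pp.
Qed.

End Graded.

(** * Lie series *)

Section LieSeries.
Variables (X : finType) (deg : X -> int).
Implicit Types (f g h : series X) (u v w : seq X) (T : series X -> series X).
Implicit Types (S : {set X}).

Lemma lie_supp S k p f : lie deg S k p f ->
  supp (fun w => [/\ all (mem S) w, wdeg deg w = p & size w = k]) f.
Proof.
elim=> {k p f} [x xS|k p|k p c f g _ IHf _ IHg|k l p q f g _ IHf _ IHg].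
- move=> w; rewrite /letter; case: (eqVneq w [:: x]) => [->|]; last by rewrite eqxx.
  by rewrite /= xS wdeg_cons wdeg_nil addr0.
- by move=> w; rewrite eqxx.
- exact: supp_lin.
rewrite /sbr -scaleNr [X in supp _ X]addrC; apply: supp_lin.
  apply: supp_smul IHg IHf => u v [uS up uk] [vS vp vk].
  by split; rewrite ?all_cat ?uS ?vS // ?wdeg_cat ?size_cat; lia.
rewrite /=; apply: supp_smul IHf IHg => u v [uS up uk] [vS vp vk].
by split; rewrite ?all_cat ?uS ?vS // ?wdeg_cat ?size_cat; lia.
Qed.

Lemma lhat_supp S p f : lhat deg S p f -> supp (fun w => all (mem S) w /\ wdeg deg w = p) f.
Proof.
move=> hf w fw; have := @lie_supp _ _ _ _ (hf (size w)) w.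
by rewrite /part eqxx => /(_ fw)[].
Qed.

Lemma lhat_homog S p f : lhat deg S p f -> homog deg p f.
Proof. by move=> /lhat_supp; apply: supp_sub => w []. Qed.

Lemma lie_homog S k p f : lie deg S k p f -> homog deg p f.
Proof. by move=> /lie_lhat /lhat_homog. Qed.

Lemma lhat_nounit S p f : lhat deg S p f -> nounit f.
Proof. by move=> /(_ 0%N) /lie0 /(congr1 (fun g => g [::])). Qed.

Lemma lie_nounit S k p f : lie deg S k p f -> nounit f.
Proof. by move=> /lie_lhat /lhat_nounit. Qed.

(** A Lie series is the sum of its homogeneous parts, hence a continuous identity
    needs checking only on the elements that [lie] generates. *)
Lemma lhat_ext S p T T' f : cont T -> cont T' ->
  (forall k g, lie deg S k p g -> T g = T' g) -> lhat deg S p f -> T f = T' f.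
Proof.
move=> cT cT' TT' hf; apply/funext => w.
have [n hn] := cT.2 (size w).+1; have [m hm] := cT'.2 (size w).+1.
pose N := maxn n m; pose f0 := \sum_(k < N) part k f.
have f0E v : (size v < N)%N -> f0 v = f v.
  move=> vN; rewrite /f0 ser_sum (bigD1 (Ordinal vN)) //= big1 ?addr0.
    by rewrite /part eqxx.
  move=> k kv; rewrite /part; case: eqP => // e; case/eqP: kv; exact: val_inj.
have lw k : (k <= N)%N -> low k (f - f0).
  by move=> kN v vk; rewrite serD serN f0E ?subrr // (leq_trans vk).
rewrite -[f](subrK f0) (contD _ _ cT) (contD _ _ cT') !serD.
rewrite [T (f - _) w]hn ?[T' (f - _) w]hm //; last 2 first.
- by apply: lw; rewrite leq_maxr.
- by apply: lw; rewrite leq_maxl.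
congr (_ + _ w); rewrite /f0 (cont_sum _ _ _ cT) (cont_sum _ _ _ cT').
by apply: eq_bigr => k _; apply: TT' (hf k).
Qed.

Lemma cont_sbr p q f : cont (sbr p q f).
Proof.
apply: cont_add (cont_smull f) _; apply: cont_opp.
exact: cont_scale (cont_smulr f).
Qed.

Lemma cont_sbrr p q g : cont (fun f => sbr p q f g).
Proof.
apply: cont_add (cont_smulr g) _; apply: cont_opp.
exact: cont_scale (cont_smull g).
Qed.

Lemma supp_sbr (P Q R : seq X -> Prop) p q f g :
  (forall u v, P u -> Q v -> R (u ++ v)) -> (forall u v, Q u -> P v -> R (u ++ v)) ->
  supp P f -> supp Q g -> supp R (sbr p q f g).
Proof.
move=> PQ QP Pf Qg; rewrite /sbr -scaleNr [X in supp _ X]addrC.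
by apply: supp_lin; [apply: supp_smul Qg Pf|apply: supp_smul Pf Qg].
Qed.

End LieSeries.

(** * The Dynkin operator relative to a set of letters *)

Section Dynkin.
Variables (X : finType) (deg : X -> int) (A : {set X}).
Implicit Types (f g h : series X) (u v w : seq X) (T : series X -> series X).
Local Notation wdeg := (wdeg deg).

Definition nout w := count [predC A] w.

(** The right-nested bracket of a word. Letters of [A] in the last place are sent
    to 0: this is what makes [rho] the Dynkin operator of the free Lie algebra on the
    iterated brackets of letters of [A] with one outer letter. *)
Fixpoint nest u : series X :=
  if u is x :: v then
    if nilp v then (if x \in A then 0 else letter x)
    else sbr (deg x) (wdeg v) (letter x) (nest v)
  else 0.

Lemma nest_cons x u : u != [::] ->
  nest (x :: u) = sbr (deg x) (wdeg u) (letter x) (nest u).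
Proof. by case: u. Qed.

Lemma nest_lie (S : {set X}) u : all (mem S) u -> lie deg S (size u) (wdeg u) (nest u).
Proof.
elim: u => [|x u IHu] /=; first by move=> _; apply: lie_zero.
move=> /andP[xS uS]; rewrite wdeg_cons.
case: nilP => [->|_].
  rewrite wdeg_nil addr0; case: ifP => _; first exact: lie_zero.
  exact: lie_letter.
by rewrite -add1n; apply: lie_br (IHu uS); apply: lie_letter.
Qed.

Lemma nest_supp u : supp (fun w => nout w = nout u /\ size w = size u) (nest u).
Proof.
have letterP x : supp (fun w => w = [:: x]) (letter x).
  by move=> w; rewrite /letter; case: (eqVneq w [:: x]); rewrite ?eqxx.
elim: u => [|x u IHu] w; first by move/eqP; case.
rewrite [nest _]/=.
case: nilP => [->|_].
  case: ifP => xA; first by move/eqP; case.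
  by move=> /letterP ->.
apply: (@supp_sbr _ _ _ (fun w => nout w = nout (x :: u) /\ size w = (size u).+1)
  _ _ _ _ _ _ (@letterP x) IHu w) => {}w v.
  by move=> -> [vn vs]; rewrite /= vs -vn.
by move=> [wn ws] ->; rewrite size_cat ws addn1 /nout count_cat /= addn0 addnC -[count _ u]wn.
Qed.

Definition rho f : series X := fun w => \sum_(u : (size w).-tuple X) f u * nest u w.

Lemma rho_cont : cont rho.
Proof.
apply: cont_local => [c f g|k f lf w wk].
  apply/funext => w; rewrite serD serZ /rho mulr_sumr -big_split.
  by apply: eq_bigr => u _; rewrite serD serZ mulrDl mulrA.
by rewrite /rho big1 // => u _; rewrite lf ?mul0r // size_tuple.
Qed.

Lemma rho_monom u : rho (monom u) = nest u.
Proof.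
apply/funext => w; rewrite /rho; have [/eqP uw|uw] := eqVneq (size u) (size w).
  rewrite (bigD1 (Tuple uw)) //= /monom eqxx mul1r big1 ?addr0 // => v vu.
  case: eqP => [e|_]; last by rewrite mul0r.
  by case/eqP: vu; apply: val_inj.
rewrite big1 => [|v _].
  apply/esym/eqP; apply: contraTT uw => /nest_supp[_ ->].
  by rewrite eqxx.
rewrite /monom; case: eqP => [e|_]; last by rewrite mul0r.
by rewrite -e size_tuple eqxx in uw.
Qed.

Lemma rho_part k f : part k (rho f) = \sum_(u : k.-tuple X) f u *: nest u.
Proof.
apply/funext => w; rewrite /part ser_sum; case: eqP => [<-|wk] //.
rewrite big1 // => u _; rewrite serZ.
have [->|/nest_supp[_ e]] := eqVneq (nest u w) 0; first by rewrite mulr0.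
by case: wk; rewrite e size_tuple.
Qed.

Lemma supp_rho (P Q : seq X -> Prop) f :
  (forall u w, P u -> nout w = nout u -> size w = size u -> Q w) ->
  supp P f -> supp Q (rho f).
Proof.
move=> PQ Pf w; apply: contra_neqP => Qw; rewrite /rho big1 // => u _.
have [->|/Pf Pu] := eqVneq (f u) 0; first by rewrite mul0r.
have [->|/nest_supp[nw sw]] := eqVneq (nest u w) 0; first by rewrite mulr0.
by case: Qw; apply: PQ Pu nw sw.
Qed.

Lemma rho_lhat (S : {set X}) p f :
  supp (fun w => all (mem S) w /\ wdeg w = p) f -> lhat deg S p (rho f).
Proof.
move=> Sf k; rewrite rho_part; apply: lie_sum => u _.
have [->|/Sf[uS <-]] := eqVneq (f u) 0; first by rewrite scale0r; apply: lie_zero.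
by apply: lieZ; rewrite -[k in lie _ _ k](size_tuple u); apply: nest_lie.
Qed.

(** The operator [rho] is a morphism for the left action of words by nested
    brackets, in which a Lie element acts by its bracket, by the Jacobi identity. *)
Lemma rho_smul_lie k p q x g : lie deg setT k p x -> homog deg q g -> nounit g ->
  rho (smul x g) = sbr p q x (rho g).
Proof.
have cR := rho_cont.
move=> hx; elim: hx q g => {k p x}
  [x _|k p|k p c f f' _ IHf _ IHf'|k l p p' f f' hf IHf hf' IHf'] q g hg g0.
- have Pg : supp (fun u => u != [::] /\ wdeg u = q) g.
    by move=> w gw; split; [apply: contraNneq gw => ->; apply/eqP|apply: hg].
  apply: (@cont_ext _ _ (fun g => rho (smul (letter x) g))
    (fun g => sbr (deg x) q (letter x) (rho g)) g _ _ _ Pg).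
  + exact: cont_comp cR (cont_smull _).
  + exact: cont_comp (cont_sbr _ _ _) cR.
  by move=> u [u0 <-]; rewrite -monom_cons !rho_monom nest_cons.
- by rewrite smul0l (cont0 cR) (cont0 (cont_sbrr _ _ _)).
- by rewrite smulPl (contP _ _ _ cR) (contP _ _ _ (cont_sbrr _ _ _)) (IHf _ _ hg) // (IHf' _ _ hg).
have hfg := homog_smul (lie_homog hf) hg; have hfg' := homog_smul (lie_homog hf') hg.
have f0 h : nounit (smul h g) by rewrite /nounit smul_nil g0 mulr0.
rewrite {1}/sbr -scaleNr addrC smulPl -!smulA (contP _ _ _ cR).
rewrite (IHf _ _ hfg' (f0 _)) (IHf' _ _ hfg (f0 _)) (IHf _ _ hg g0) (IHf' _ _ hg g0).
by rewrite [sbr p (p' + q) _ _]sbr_jacobi scaleNr addrCA addNr addr0.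
Qed.

Definition nmul f : series X := fun w => (nout w)%:R * f w.
Definition ndiv f : series X := fun w => (nout w)%:R^-1 * f w.

Lemma nmul_cont : cont nmul.
Proof.
apply: cont_local => [c f g|k f lf w wk]; last by rewrite /nmul lf ?mulr0.
by apply/funext => w; rewrite /nmul !serE mulrDr mulrCA.
Qed.

Lemma ndiv_cont : cont ndiv.
Proof.
apply: cont_local => [c f g|k f lf w wk]; last by rewrite /ndiv lf ?mulr0.
by apply/funext => w; rewrite /ndiv !serE mulrDr mulrCA.
Qed.

Lemma nmul_smul f g : nmul (smul f g) = smul (nmul f) g + smul f (nmul g).
Proof.
apply/funext => w; rewrite serD /nmul /smul mulr_sumr -big_split.
apply: eq_bigr => i _ /=.
rewrite -{1}(cat_take_drop i w) /nout count_cat natrD; ring.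
Qed.

Lemma nmul_sbr p q f g : nmul (sbr p q f g) = sbr p q (nmul f) g + sbr p q f (nmul g).
Proof.
have cN := nmul_cont.
rewrite /sbr (contD _ _ cN) -scaleNr (contZ _ _ cN) !nmul_smul.
by apply/funext => w; rewrite !serE; ring.
Qed.

(** The analogue of the Dynkin-Specht-Wever theorem: on Lie elements both sides are
    derivations, which agree on letters. *)
Lemma rho_lie k p x : lie deg setT k p x -> rho x = nmul x.
Proof.
have [cR cN] := (rho_cont, nmul_cont).
elim=> {k p x} [x _|k p|k p c f f' _ IHf _ IHf'|k l p q f g hf IHf hg IHg].
- rewrite -[letter x]/(monom [:: x]) rho_monom /=; apply/funext => w.
  rewrite /nmul /monom; case: eqVneq => [->|wx]; last first.
    by rewrite mulr0; case: ifP => // _; rewrite /letter (negbTE wx).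
  by rewrite /nout /= addn0 mulr1; case: ifP => _; rewrite //= /letter eqxx.
- by rewrite (cont0 cR) (cont0 cN).
- by rewrite (contP _ _ _ cR) (contP _ _ _ cN) IHf IHf'.
rewrite {1}/sbr (contD _ _ cR) -scaleNr (contZ _ _ cR).
rewrite (rho_smul_lie hf (lie_homog hg) (lie_nounit hg)).
rewrite (rho_smul_lie hg (lie_homog hf) (lie_nounit hf)).
by rewrite IHf IHg nmul_sbr [sbr p q (nmul f) g]sbr_anti scaleNr addrC.
Qed.

Lemma rho_ndiv f : rho (ndiv f) = ndiv (rho f).
Proof.
apply: (@cont_ext _ (fun=> True) (fun f => rho (ndiv f)) (fun f => ndiv (rho f))) => //.
- exact: cont_comp rho_cont ndiv_cont.
- exact: cont_comp ndiv_cont rho_cont.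
move=> u _; have -> : ndiv (monom u) = (nout u)%:R^-1 *: monom u.
  apply/funext => w; rewrite /ndiv serZ /monom.
  by case: eqVneq => [->|]; rewrite ?mulr0.
rewrite (contZ _ _ rho_cont) rho_monom; apply/funext => w; rewrite serZ /ndiv.
by have [->|/nest_supp[-> _]] := eqVneq (nest u w) 0; rewrite ?mulr0.
Qed.

(** Since [rho] is diagonal on Lie series, dividing by its eigenvalues inverts it. *)
Lemma rho_id p x : lhat deg setT p x -> supp (fun w => (0 < nout w)%N) x ->
  rho (ndiv x) = x.
Proof.
move=> hx x0; rewrite rho_ndiv (lhat_ext rho_cont nmul_cont (@rho_lie^~ p) hx).
apply/funext => w; rewrite /ndiv /nmul.
have [->|/x0 w0] := eqVneq (x w) 0; first by rewrite !mulr0.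
by rewrite mulKf // (Num.Theory.pnatr_eq0 rat) -lt0n.
Qed.

Lemma supp_ndiv P f : supp P f -> supp P (ndiv f).
Proof. by move=> Pf w; rewrite /ndiv mulf_eq0 => /norP[_ /Pf]. Qed.

Variable F : X -> series X.
Hypothesis F_lie : forall x, lhat deg setT (deg x - 1) (F x).
Hypothesis F_nout : forall x, supp (fun w => nout w = nout [:: x]) (F x).

(** For a word ending in an outer letter this is the compatibility of derivations
    with brackets; for a word ending in [A] both sides vanish, as the derivation maps
    [A] to series in the letters of [A]. *)
Lemma rho_sder f : rho (sder deg F f) = sder deg F (rho f).
Proof.
have F0 x : nounit (F x) := lhat_nounit (F_lie x).
have FL : lowers deg F by move=> x; apply: lhat_homog (F_lie x).
have [cR cF] := (rho_cont, sder_cont deg F0).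
apply: (@cont_ext _ (fun=> True) (fun f => rho (sder deg F f))
  (fun f => sder deg F (rho f))) => //.
- exact: cont_comp cR cF.
- exact: cont_comp cF cR.
move=> u _; rewrite rho_monom; elim: u => [|x u IHu].
  by rewrite sder_nil (cont0 cR) sder0.
have [->|u0] := eqVneq u [::].
  rewrite [monom _]/(letter x) sder_letter (lhat_ext cR nmul_cont (@rho_lie^~ _) (F_lie x)).
  apply/funext => w; rewrite /nmul; have [Fw|Fw] := eqVneq (F x w) 0; last first.
    rewrite (F_nout Fw) /nout /= addn0; case: ifP => _; first by rewrite mul0r sder0.
    by rewrite mul1r sder_letter.
  by rewrite Fw mulr0 /=; case: ifP => _; rewrite ?sder0 // sder_letter Fw.
have m0 : nounit (monom u) by rewrite /nounit /monom eq_sym (negbTE u0).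
have hd : homog deg (wdeg u - 1) (sder deg F (monom u)).
  exact: homog_sder FL (@homog_monom _ _ _).
have d0 : nounit (sder deg F (monom u)) by apply: (sder_local deg F0 (k := 1)) => // -[].
rewrite monom_cons sder_letterl (contD _ _ cR) (contZ _ _ cR).
have -> : rho (smul (F x) (monom u)) = sbr (deg x - 1) (wdeg u) (F x) (rho (monom u)).
  apply: (lhat_ext (T := fun h => rho (smul h (monom u)))
    (T' := fun h => sbr (deg x - 1) (wdeg u) h (rho (monom u))) _ _ _ (F_lie x)).
  - exact: cont_comp cR (cont_smulr _).
  - exact: cont_sbrr.
  by move=> k h hh; apply: rho_smul_lie hh (@homog_monom _ _ _) m0.
rewrite (rho_smul_lie (lie_letter deg (in_setT x)) hd d0) IHu nest_cons //.
rewrite (sder_sbr F0 (@homog_letter _ _ _)) ?sder_letter ?rho_monom //.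
apply: (@lie_homog _ _ setT) (nest_lie _); apply/allP => y _; exact: in_setT.
Qed.

Lemma ndiv_sder f : ndiv (sder deg F f) = sder deg F (ndiv f).
Proof.
have cF := sder_cont deg (fun x => lhat_nounit (F_lie x)).
apply: (@cont_ext _ (fun=> True) (fun f => ndiv (sder deg F f))
  (fun f => sder deg F (ndiv f))) => //.
- exact: cont_comp ndiv_cont cF.
- exact: cont_comp cF ndiv_cont.
move=> u _; have uP (w : seq X) : monom u w != 0 -> nout w = nout u.
  by rewrite /monom; case: (eqVneq w u) => [->|]; rewrite ?eqxx.
have -> : ndiv (monom u) = (nout u)%:R^-1 *: monom u.
  apply/funext => w; rewrite /ndiv serZ.
  by have [->|/uP->] := eqVneq (monom u w) 0; rewrite ?mulr0.
rewrite (contZ _ _ cF); apply/funext => w; rewrite serZ /ndiv.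
have [->|] := eqVneq (sder deg F (monom u) w) 0; first by rewrite !mulr0.
move=> dw; suff -> : nout w = nout u by [].
move: w dw; apply: (supp_sder _ uP) => v x v' s <- /F_nout.
by rewrite /nout !count_cat /= => ->; lia.
Qed.

End Dynkin.

(** * Stripping the letter before the first outer letter *)

Section Strip.
Variables (X : finType) (deg : X -> int) (A : {set X}) (eps : X -> rat).
Hypothesis epsA : forall t, eps t != 0 -> t \in A.
Hypothesis eps_deg : forall t, eps t != 0 -> deg t = -1.
Implicit Types (f g h : series X) (u v w : seq X) (T : series X -> series X).
Local Notation wdeg := (wdeg deg).
Local Notation homog := (homog deg).

Definition out_head w := if w is x :: _ then x \notin A else false.

Definition lead f : series X := fun w => if out_head w then f w else 0.

Lemma lead_cont : cont lead.
Proof.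
apply: cont_local => [c f g|k f lf w wk]; last by rewrite /lead lf // if_same.
by apply/funext => w; rewrite !serE /lead; case: ifP => _; rewrite ?mulr0 ?addr0.
Qed.

Lemma lead_id f : supp out_head f -> lead f = f.
Proof.
move=> sf; apply/funext => w; rewrite /lead; case: ifP => // /negP ow.
by apply/esym/eqP; apply: contra_notT ow; apply: sf.
Qed.

Lemma lead_eq0 f : supp (fun w => ~~ out_head w) f -> lead f = 0.
Proof.
move=> sf; apply/funext => w; rewrite /lead; case: ifP => // ow.
by apply/eqP; apply: contraTT ow; apply: sf.
Qed.

Lemma supp_out_letter x f : x \notin A -> supp out_head (smul (letter x) f).
Proof.
move=> xA [|y w]; first by rewrite smul_nil mul0r eqxx.
by rewrite smul_letter /=; case: (eqVneq y x) => [->|] //; rewrite mul0r eqxx.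
Qed.

Lemma supp_in_smul f g : nounit f -> supp (fun w => all (mem A) w) f ->
  supp (fun w => ~~ out_head w) (smul f g).
Proof.
move=> f0 sf; have sf' : supp (fun w => w != [::] /\ all (mem A) w) f.
  by move=> w fw; split; [apply: contraNneq fw => ->; apply/eqP|apply: sf].
apply: (supp_smul (Q := fun=> True) _ sf') => // -[|x u] v [] //= _ /andP[xA _] _.
by rewrite xA.
Qed.

(** In terms of words, [u t x v], with [u] in [A], [t] in [A] and [x] outside [A], is
    sent to [u x v] times [eps t] and the sign of [u]. The definition is dual: it gives
    the coefficient of a word [u x v] in the image. *)
Fixpoint strip f w : rat :=
  if w is x :: v then
    if x \in A then sg (deg x) * strip (lder x f) v
    else \sum_t eps t * f [:: t, x & v]
  else 0.

Lemma strip_cont : cont strip.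
Proof.
split=> [c f g|k].
  apply/funext => w; rewrite serD serZ; elim: w f g => [|x w IHw] f g /=.
    by rewrite mulr0 addr0.
  case: ifP => _; first by rewrite -[lder x _]/(c *: lder x f + lder x g) IHw; ring.
  by rewrite mulr_sumr -big_split; apply: eq_bigr => t _; rewrite serD serZ /=; ring.
exists k.+1 => f lf w; elim: w k f lf => [|x w IHw] // k f lf wk /=.
case: ifP => _; last by rewrite big1 // => t _; rewrite lf ?mulr0.
rewrite (IHw k.-1) ?mulr0 //; last by move: wk => /=; lia.
by move=> v vk; rewrite /lder lf //=; move: wk vk => /=; lia.
Qed.

Lemma strip_letterl x f : strip (smul (letter x) f) =
  if x \in A then sg (deg x) *: smul (letter x) (strip f) + eps x *: lead f else 0.
Proof.
have s0 := cont0 strip_cont.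
apply/funext => -[|y w] /=.
  by case: ifP => _; rewrite // !serE smul_nil mul0r !mulr0.
rewrite lder_letter; have [yA|yA] := boolP (y \in A).
  have [xA|xA] := boolP (x \in A).
    rewrite !serE smul_letter /lead /= yA mulr0 addr0.
    have [->|_] := eqVneq; first by rewrite scale1r mul1r.
    by rewrite scale0r s0 mul0r !mulr0.
  have [xy|_] := eqVneq; first by rewrite -xy yA in xA.
  by rewrite scale0r s0 mulr0.
rewrite (bigD1 x) //= smul_letter eqxx mul1r big1 ?addr0 => [|t /negbTE tx]; last first.
  by rewrite smul_letter tx mul0r mulr0.
have [xA|xA] := boolP (x \in A); last first.
  by have [->|/epsA] := eqVneq (eps x) 0; [rewrite mul0r|rewrite (negbTE xA)].
rewrite !serE smul_letter /lead /= yA.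
by have [xy|_] := eqVneq; [rewrite xy xA in yA|rewrite mul0r mulr0 add0r].
Qed.

Lemma strip_nil : strip (monom [::]) = 0.
Proof.
apply/funext => -[|x w] //=; case: ifP => _.
  by rewrite (_ : lder x _ = 0) ?(cont0 strip_cont) ?mulr0 //; apply/funext.
by rewrite big1 // => t _; rewrite mulr0.
Qed.

Lemma strip_out f : supp out_head f -> strip f = 0.
Proof.
move=> sf; have fA x w : x \in A -> f (x :: w) = 0.
  by move=> xA; apply/eqP; apply: contraTT xA; apply: sf.
apply/funext => -[|x w] //=; case: ifP => xA.
  by rewrite (_ : lder x f = 0) ?(cont0 strip_cont) ?mulr0 //; apply/funext => v; apply: fA.
rewrite big1 // => t _; have [->|/epsA tA] := eqVneq (eps t) 0; first by rewrite mul0r.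
by rewrite fA // mulr0.
Qed.

Lemma supp_strip (P Q : seq X -> Prop) f :
  (forall u t x v, P (u ++ [:: t, x & v]) -> eps t != 0 -> x \notin A ->
    Q (u ++ x :: v)) ->
  supp P f -> supp Q (strip f).
Proof.
move=> PQ Pf w; elim: w P Q PQ f Pf => [|x w IHw] P Q PQ f Pf; first by move/eqP; case.
apply: contra_neqP => Qw /=; case: ifPn => xA.
  have [->|/IHw] := eqVneq (strip (lder x f) w) 0; first by rewrite mulr0.
  move=> /(_ (P \o cons x) (Q \o cons x)) /= Qxw; case: Qw.
  by apply: Qxw => [u t y v|v /Pf //]; apply: (PQ (x :: u)).
rewrite big1 // => t _; have [->|et] := eqVneq (eps t) 0; first by rewrite mul0r.
have [->|/Pf Pt] := eqVneq (f [:: t, x & w]) 0; first by rewrite mulr0.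
by case: Qw; apply: (PQ [::] t x w).
Qed.

(** Deletion of the last letter, which is what [strip] does to the left factor [u] of
    [u b] when [b] starts with an outer letter. *)
Definition rstrip f : series X :=
  fun w => sg (wdeg w) * \sum_t eps t * f (rcons w t).

Lemma rstrip_cont : cont rstrip.
Proof.
split=> [c f g|k].
  apply/funext => w; rewrite serD serZ /rstrip mulrCA -mulrDr; congr (_ * _).
  by rewrite mulr_sumr -big_split; apply: eq_bigr => t _; rewrite serD serZ /=; ring.
exists k.+1 => f lf w wk; rewrite /rstrip big1 ?mulr0 // => t _.
by rewrite lf ?mulr0 // size_rcons.
Qed.

Lemma rstrip_nil : rstrip (monom [::]) = 0.
Proof.
apply/funext => w; rewrite /rstrip big1 ?mulr0 // => t _.
by rewrite /monom -size_eq0 size_rcons mulr0.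
Qed.

Lemma rstrip_cons x u : rstrip (monom (x :: u)) =
  sg (deg x) *: smul (letter x) (rstrip (monom u)) + (eps x * (u == [::])%:R) *: monom [::].
Proof.
apply/funext => -[|y w]; rewrite !serE.
  rewrite smul_nil mul0r mulr0 add0r mulr1 /rstrip wdeg_nil mul1r.
  rewrite (bigD1 x) //= big1 => [|t /negbTE tx]; last first.
    by rewrite /monom eqseq_cons tx mulr0.
  by rewrite addr0 /monom eqseq_cons eqxx eq_sym.
rewrite smul_letter mulr0 addr0 /rstrip wdeg_cons sgnD.
have -> : \sum_t eps t * monom (x :: u) (rcons (y :: w) t)
    = (y == x)%:R * \sum_t eps t * monom u (rcons w t).
  rewrite mulr_sumr; apply: eq_bigr => t _.
  by rewrite /monom eqseq_cons mulrCA -natrM mulnb.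
by case: eqVneq => [->|_]; rewrite ?mul0r ?mulr0 // !mul1r mulrA.
Qed.

(** The prefix [f] is left intact by the deletion of a letter of [g], unless [g] begins
    with an outer letter, in which case [f] loses its last letter. *)
Lemma strip_smul p f g : homog p f -> supp (fun w => all (mem A) w) f ->
  strip (smul f g) = sg p *: smul f (strip g) + smul (rstrip f) (lead g).
Proof.
move=> pf Af; have sf : supp (fun w => all (mem A) w /\ wdeg w = p) f.
  by move=> w fw; split; [apply: Af|apply: pf].
apply: (@cont_ext _ _ (fun f => strip (smul f g))
  (fun f => sg p *: smul f (strip g) + smul (rstrip f) (lead g)) f _ _ _ sf).
- exact: cont_comp strip_cont (cont_smulr _).
- apply: cont_add; first exact: cont_scale (cont_smulr _).
  exact: cont_comp (cont_smulr _) rstrip_cont.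
move=> {f pf Af sf} u [uA <-]; elim: u uA => [_|x u IHu].
  by rewrite !smul1l wdeg_nil scale1r rstrip_nil smul0l addr0.
move=> /andP[xA uA]; have {}xA : x \in A by [].
rewrite wdeg_cons sgnD monom_cons -smulA strip_letterl xA IHu // -monom_cons rstrip_cons.
rewrite smulDl !smulZl smul1l monom_cons -!smulA.
rewrite [in LHS]raddfD /= linearZ /= scalerDr scalerA -!addrA; congr (_ + (_ + _)).
case: u uA {IHu} => [_|y u uA] /=.
  by rewrite smul1l mulr1.
rewrite mulr0 scale0r lead_eq0 ?scaler0 //.
apply: supp_in_smul => // w; rewrite /monom.
by case: (eqVneq w (y :: u)) => [->|]; rewrite ?eqxx.
Qed.

Section Homotopy.
Variables (a : X) (F L : X -> series X).
Hypotheses (aA : a \in A) (eps_a : eps a = 1).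
Hypothesis F0 : forall x, nounit (F x).
Hypothesis F_low : lowers deg F.
Hypothesis F_in : forall x, x \in A -> supp (fun w => all (mem A) w) (F x).
(** For [F x = d x + q x + [a, x]] with [d] linear and [q] quadratic, this says that
    [eps] vanishes on [d x] and is a counit for [q]: the contributions of [q x] and of
    [x a] cancel, leaving that of [a x]. *)
Hypothesis F_rstrip : forall x, x \in A -> rstrip (F x) = - eps x *: letter a.
Hypothesis L_out : forall x, x \notin A -> supp out_head (L x).
Hypothesis F_out : forall x, x \notin A -> F x = L x + sbr (-1) (deg x) (letter a) (letter x).

Local Notation delta := (sder deg F : series X -> series X).

Let cD : cont delta := sder_cont deg F0.

Lemma F_outl x f : x \notin A -> smul (F x) f =
  smul (L x) f + smul (letter a) (smul (letter x) f)
    - sg (deg x) *: smul (letter x) (smul (letter a) f).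
Proof.
move=> xA; rewrite F_out // smulDl /sbr mulN1r sgN smulDl -scaleNr smulZl.
by rewrite scaleNr -!smulA addrA.
Qed.

Lemma supp_out_L x f : x \notin A -> supp out_head (smul (L x) f).
Proof. by move=> xA; apply: (supp_smul (Q := fun=> True)) (@L_out x xA) _ => // -[|y u]. Qed.

Lemma supp_in_a f : supp (fun w => ~~ out_head w) (smul (letter a) f).
Proof.
apply: supp_in_smul => // w; rewrite /letter.
by case: (eqVneq w [:: a]) => [->|]; rewrite ?eqxx //= aA.
Qed.

(** Among the terms of [delta], only [[a, x]] can put a letter of [A] in front of a
    word that begins with the outer letter [x]. *)
Lemma sder_lead f : delta (lead f) = lead (delta f) + smul (letter a) (lead f).
Proof.
have cL := lead_cont; have c1 := cont_comp cL cD.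
apply: (@cont_ext _ (fun=> True) (fun f => delta (lead f))
  (fun f => lead (delta f) + smul (letter a) (lead f))) => //.
- exact: cont_comp cD cL.
- apply: cont_add => //; exact: cont_comp (cont_smull _) cL.
move=> {}f _; case: f => [|x u].
  rewrite sder_nil (cont0 cL) lead_eq0 ?raddf0 ?addr0 ?sder0 // => w.
  by rewrite /monom; case: (eqVneq w [::]) => [->|]; rewrite ?eqxx.
rewrite monom_cons sder_letterl; have [xA|xA] := boolP (x \in A).
  have out_x h : lead (smul (letter x) h) = 0.
    apply: lead_eq0; apply: supp_in_smul => // w; rewrite /letter.
    by case: (eqVneq w [:: x]) => [->|]; rewrite ?eqxx //= xA.
  rewrite out_x (contD _ _ cL) (contZ _ _ cL) out_x scaler0 raddf0 !addr0 sder0.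
  by rewrite lead_eq0 //; apply: supp_in_smul; [apply: F0|apply: F_in].
rewrite F_outl // lead_id; last exact: supp_out_letter.
rewrite sder_letterl F_outl // !(contD _ _ cL) -scaleN1r !(contZ _ _ cL).
rewrite [lead (smul (L x) _)]lead_id; last exact: supp_out_L.
rewrite [lead (smul (letter a) _)]lead_eq0; last exact: supp_in_a.
rewrite ![lead (smul (letter x) _)]lead_id; try exact: supp_out_letter.
by rewrite addr0 -!addrA; congr (_ + _); rewrite addrC -addrA.
Qed.

Local Notation K f := (strip (delta f) + delta (strip f)).

(** Stripping [x] before and after applying [delta] gives terms that differ by
    [sder_lead]; the difference cancels against the terms in which [strip] shortens the
    value of [delta] on [x], which [F_rstrip] computes. *)
Lemma homotopy_in x f : x \in A -> K (smul (letter x) f) = smul (letter x) (K f).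
Proof.
move=> xA; have cS := strip_cont.
rewrite sder_letterl (contD _ _ cS) (contZ _ _ cS) !strip_letterl xA.
rewrite (strip_smul _ (@F_low x) (@F_in x xA)) F_rstrip // sgB1.
rewrite (contD _ _ cD) !(contZ _ _ cD) sder_letterl sder_lead smulZl.
have xx : sg (deg x) * sg (deg x) = 1 by exact: sgn_sq.
have xe : sg (deg x) * eps x = - eps x.
  have [->|/eps_deg ->] := eqVneq (eps x) 0; first by rewrite mulr0 oppr0.
  by rewrite sgN1 mulN1r.
rewrite [RHS]raddfD /=; apply/funext => w; rewrite !serE.
by ring: xx xe.
Qed.

(** The only surviving term arises from [[a, x]], whose letter [a] is stripped. *)
Lemma homotopy_out x f : x \notin A -> K (smul (letter x) f) = smul (letter x) f.
Proof.
move=> xA; have cS := strip_cont.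
rewrite [strip (smul _ _)]strip_letterl (negbTE xA) sder0 addr0.
rewrite sder_letterl F_outl // !(contD _ _ cS) -scaleN1r !(contZ _ _ cS).
rewrite ![strip (smul (letter x) _)]strip_letterl (negbTE xA) !scaler0 !addr0.
rewrite strip_out ?add0r; last exact: supp_out_L.
rewrite strip_letterl aA strip_letterl (negbTE xA) raddf0 scaler0 add0r eps_a scale1r.
by rewrite lead_id //; apply: supp_out_letter.
Qed.

(** The identity propagates through the letters of [A] in front of a word by
    [homotopy_in], and holds from the first outer letter on by [homotopy_out]. *)
Lemma strip_homotopy f : supp (fun w => 0 < nout A w)%N f -> K f = f.
Proof.
have cS := strip_cont.
apply: (@cont_ext _ _ (fun f => K f) id); last 1 first.
- move=> u; rewrite /nout -has_count; suff -> : K (monom u) = (has (predC (mem A)) u)%:R *: monom u.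
    by move=> ->; rewrite scale1r.
  elim: u => [|x u IHu].
    by rewrite strip_nil sder_nil (cont0 cS) (cont0 cD) addr0 scale0r.
  rewrite monom_cons; have [xA|xA] := boolP (x \in A).
    by rewrite homotopy_in // IHu linearZ /= xA.
  by rewrite homotopy_out //= xA scale1r.
- by apply: cont_add; apply: cont_comp.
- exact: cont_id.
Qed.
End Homotopy.
End Strip.

(** * Differentials as derivations of series *)

Section Extension.
Variables (X : finType) (deg : X -> int).
Local Notation L := (free_gla deg).
Variable D : differential L.
Implicit Types (f g : series X) (u v w : seq X).

Definition gen_dif x : series X := free_val (dif D (erefl (deg x - 1)) (gen (erefl (deg x)))).

Lemma gen_dif_lhat x : lhat deg setT (deg x - 1) (gen_dif x).
Proof. exact: free_lhat. Qed.

Local Notation delta := (sder deg gen_dif : series X -> series X).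

Let cD : cont delta := sder_cont deg (fun x => lhat_nounit (gen_dif_lhat x)).

Lemma lhatT S p f : lhat deg S p f -> lhat deg setT p f.
Proof. exact/lhat_sub/subsetT. Qed.

Lemma wlen_ge_low k f : wlen_ge k f -> low k f.
Proof. by move=> kf w /kf /(congr1 (fun g => g w)); rewrite /part eqxx. Qed.

Lemma dif_sder_lie k p f : lie deg setT k p f -> forall q (h : p - 1 = q) (x : L p),
  free_val x = f -> free_val (dif D h x) = delta f.
Proof.
have F0 x : nounit (gen_dif x) := lhat_nounit (gen_dif_lhat x).
elim=> {k p f}
  [x xS|k p|k p c f g hf IHf hg IHg|k l p p' f g hf IHf hg IHg] q h y yf.
- have -> : y = gen (erefl (deg x)) by apply: val_inj.
  by case: q / h; rewrite sder_letter.
- have -> : y = 0 by apply: val_inj.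
  by rewrite raddf0 sder0.
- have -> : y = c *: (FreeElt (lie_free hf) : L p) + (FreeElt (lie_free hg) : L p).
    by apply: val_inj.
  by rewrite linearP (contP _ _ _ cD) free_val_lin (IHf _ h) // (IHg _ h).
have -> : y = br (erefl (p + p'))
    (FreeElt (lie_free hf) : L p) (FreeElt (lie_free hg) : L p').
  by apply: val_inj.
have h1 : p - 1 + p' = q by rewrite -h addrAC.
have h2 : p + (p' - 1) = q by rewrite -h addrA.
rewrite (dif_br D _ erefl erefl h h1 h2) addrC free_val_lin addrC.
rewrite (sder_sbr F0 (lie_homog hf) (lie_homog hg)) /=.
by rewrite (IHf _ erefl) // (IHg _ erefl).
Qed.

(** A differential of a free complete graded Lie algebra is the restriction of a
    derivation of the algebra of all series, where one can compute on words. *)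
Lemma dif_sder p q (h : p - 1 = q) (x : L p) :
  free_val (dif D h x) = delta (free_val x).
Proof.
apply/funext => w; pose N := (size w).+1; have hx := free_lhat x.
pose X' : L p := \sum_(j < N) (FreeElt (lie_free (hx j)) : L p).
have lx : wlen_ge N (free_val (x - X')).
  move=> i iN; rewrite -scaleN1r addrC free_val_lin part_lin scaleN1r.
  rewrite free_val_sum raddf_sum (bigD1 (Ordinal iN)) //= part_part eqxx.
  rewrite big1 ?addr0 ?addNr // => j ji; rewrite part_part ifN //.
  by apply: contra ji => /eqP e; apply/eqP/val_inj.
have -> : x = 1 *: (x - X') + X' by rewrite scale1r subrK.
rewrite linearP !free_val_lin (contP _ _ _ cD) !serD !serZ !mul1r.
rewrite (wlen_ge_low (dif_wlen_ge D h lx)) //.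
rewrite (sder_local deg (fun x => lhat_nounit (gen_dif_lhat x)) (wlen_ge_low lx)) //.
congr (_ + _ w); rewrite raddf_sum !free_val_sum (cont_sum _ _ _ cD).
by apply: eq_bigr => j _; apply: dif_sder_lie (hx j) _ _ _ _.
Qed.

Lemma sder_lhat (S : {set X}) p f :
  (forall x, x \in S -> lhat deg S (deg x - 1) (gen_dif x)) ->
  lhat deg S p f -> lhat deg S (p - 1) (delta f).
Proof.
move=> DS hf; have hf' : f \in free_pred deg p by apply/asboolP/lhatT/hf.
rewrite -[f]/(free_val (FreeElt hf' : L p)) -(dif_sder erefl).
apply: dif_lhat => // x xS q h; case: q / h; exact: DS.
Qed.

Lemma sder_sder p f : lhat deg setT p f -> delta (delta f) = 0.
Proof.
move=> hf; have hf' : f \in free_pred deg p by apply/asboolP.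
rewrite -[f]/(free_val (FreeElt hf' : L p)) -(dif_sder erefl) -(dif_sder erefl).
by rewrite (dif_dif D).
Qed.

End Extension.

(** * Acyclicity relative to a set of generators *)

Arguments nout : simpl never.

Section Acyclic.
Variables (X : finType) (deg : X -> int).
Variable D : differential (free_gla deg).
Variables (A S : {set X}) (eps : X -> rat) (a : X).
Local Notation F := (gen_dif D).
Local Notation delta := (sder deg F : series X -> series X).
Local Notation nout := (nout A).
Hypothesis AS : A \subset S.
Hypotheses (aA : a \in A) (a_deg : deg a = -1) (eps_a : eps a = 1).
Hypothesis epsA : forall t, eps t != 0 -> t \in A.
Hypothesis eps_deg : forall t, eps t != 0 -> deg t = -1.
Hypothesis F_in : forall x, x \in A -> lhat deg A (deg x - 1) (F x).
Hypothesis F_out : forall x, x \in S :\: A -> exists2 r,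
  lhat deg (S :\: A) (deg x - 1) r & F x = r + sbr (-1) (deg x) (letter a) (letter x).
(** The two conditions on [eps] say that it is a counit for the linear and quadratic
    parts of the untwisted differential, expressed after the twist by [a]. *)
Hypothesis F_eps1 : forall x, x \in A -> \sum_t eps t * F x [:: t] = 0.
Hypothesis F_eps2 : forall x, x \in A ->
  forall s, \sum_t eps t * F x [:: s; t] = eps x * (s == a)%:R.
Implicit Types (f g : series X) (u v w : seq X).

Definition wt w := (size w + nout w)%N.

Lemma wt_cat u v : wt (u ++ v) = (wt u + wt v)%N.
Proof. by rewrite /wt size_cat /nout count_cat addnACA. Qed.

Lemma wt_cons x w : wt (x :: w) = (wt [:: x] + wt w)%N.
Proof. exact: (wt_cat [:: x]). Qed.

Lemma nout_cat u v : nout (u ++ v) = (nout u + nout v)%N.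
Proof. exact: count_cat. Qed.

Lemma nout1 x : nout [:: x] = (x \notin A).
Proof. by rewrite /nout /= addn0. Qed.

Lemma nout_eq0 w : (nout w == 0%N) = all (mem A) w.
Proof. by rewrite eqn0Ngt -has_count -all_predC; apply: eq_all => x /=; rewrite negbK. Qed.

Lemma bracket_lie x :
  lie deg setT 2 (deg x - 1) (sbr (-1) (deg x) (letter a) (letter x)).
Proof.
rewrite -[2%N]/(1 + 1)%N addrC; apply: lie_br; last exact: lie_letter.
by rewrite -a_deg; apply: lie_letter.
Qed.

Definition low_lin x := if x \in S then part 1 (F x) else 0.

(** The value on [x] of the part of the differential that raises [wt] by at most 1.
    It has to be defined on all letters, including those outside [S], where only its
    compatibility with [strip] and [rho] matters. *)
Definition low_dif x :=
  if x \in A then part 1 (F x) + part 2 (F x)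
  else low_lin x + sbr (-1) (deg x) (letter a) (letter x).

Local Notation delta1 := (sder deg low_dif : series X -> series X).

Lemma low_lin_out x : x \notin A ->
  supp (fun w => [/\ size w = 1%N & nout w = 1%N]) (low_lin x).
Proof.
move=> xA w; rewrite /low_lin; case: ifP => xS; last by move/eqP; case.
have /F_out[r hr ->] : x \in S :\: A by rewrite inE xA.
rewrite raddfD /= -(lie_part (bracket_lie x)) part_part /= addr0.
move=> /(lie_supp (hr 1%N))[wS _ w1]; split=> //.
case: w w1 wS => [|y []] //= _ /andP[]; rewrite inE => /andP[yA _] _.
by rewrite nout1 yA.
Qed.

Lemma low_dif_lhat x : lhat deg setT (deg x - 1) (low_dif x).
Proof.
have hp k : lhat deg setT (deg x - 1) (part k (F x)).
  exact: lie_lhat (gen_dif_lhat D x k).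
rewrite /low_dif; case: ifP => _.
  by rewrite -[part 1 _]scale1r; apply: lhat_lin.
rewrite -[low_lin x]scale1r; apply: lhat_lin; last exact: lie_lhat (bracket_lie x).
by rewrite /low_lin; case: ifP => // _; apply: lhat0.
Qed.

Lemma bracket_supp x : supp (fun w => nout w = nout [:: x] /\ size w = 2%N)
  (sbr (-1) (deg x) (letter a) (letter x)).
Proof.
have letterP y : supp (fun w => w = [:: y]) (letter y).
  by move=> w; rewrite /letter; case: (eqVneq w [:: y]); rewrite ?eqxx.
by apply: (@supp_sbr _ _ _ (fun w => nout w = nout [:: x] /\ size w = 2%N)
  _ _ _ _ _ _ (@letterP a) (@letterP x)) => _ _ -> ->; rewrite nout_cat !nout1 aA ?addn0.
Qed.

Lemma part_in x k w : x \in A -> part k (F x) w != 0 -> all (mem A) w /\ size w = k.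
Proof. by move=> xA /(lie_supp (F_in xA k))[]. Qed.

Lemma low_dif_in x : x \in A -> supp (fun w => all (mem A) w) (low_dif x).
Proof.
move=> xA; rewrite /low_dif xA -[part 1 _]scale1r.
by apply: supp_lin => w /(part_in xA)[].
Qed.

Lemma low_dif_nout x : supp (fun w => nout w = nout [:: x]) (low_dif x).
Proof.
have [xA|xA] := boolP (x \in A).
  move=> w /(low_dif_in xA); rewrite -nout_eq0 => /eqP ->.
  by rewrite nout1 xA.
rewrite /low_dif (negbTE xA) -[low_lin x]scale1r; apply: supp_lin => w.
  by move=> /(low_lin_out xA)[_ ->]; rewrite nout1 xA.
by move=> /bracket_supp[].
Qed.

(** In the letters of [A], what is left consists of words of length at least 3; for an
    outer [x] it consists of words of at least two outer letters, of weight at least 4. *)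
Lemma dif_gap x : x \in S ->
  supp (fun w => (wt [:: x] + 2 <= wt w)%N) (F x - low_dif x).
Proof.
move=> xS w; rewrite serD serN /low_dif; case: ifPn => xA.
  have Fw0 : F x [::] = 0 := lhat_nounit (F_in xA).
  rewrite serD /part; case: w => [|y [|z [|t w]]] /=.
  - by rewrite Fw0 !(addr0, oppr0) eqxx.
  - by rewrite addr0 subrr eqxx.
  - by rewrite add0r subrr eqxx.
  by move=> _; rewrite /wt nout1 xA /=; lia.
rewrite /low_lin xS; have /F_out[r hr ->] : x \in S :\: A by rewrite inE xA.
have p0 : part 1 (sbr (-1) (deg x) (letter a) (letter x)) = 0.
  by rewrite -(lie_part (bracket_lie x)) part_part.
rewrite [part 1 _]raddfD /= p0 addr0 serD [X in _ - X]serD opprD addrACA subrr addr0.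
rewrite /part; case: ifPn => w1; first by rewrite subrr eqxx.
rewrite subr0 => rw; have [wS _] := lhat_supp hr rw.
have -> : wt w = (size w).*2.
  rewrite /wt -addnn; congr (_ + _)%N; apply/eqP; rewrite -all_count.
  by apply: sub_all wS => y; rewrite /= inE => /andP[].
have : size w != 0%N by apply: contraNneq rw => /size0nil ->; apply/eqP/(lhat_nounit hr).
by rewrite /wt nout1 xA /=; lia.
Qed.

Lemma low_dif_rstrip x : x \in A -> rstrip deg eps (low_dif x) = - eps x *: letter a.
Proof.
move=> xA; apply/funext => w; rewrite serZ /rstrip /low_dif xA.
case: w => [|s [|y w]].
- rewrite mulr0 wdeg_nil mul1r -[RHS](F_eps1 xA); apply: eq_bigr => t _.
  by rewrite serD /part /= addr0.
- rewrite wdeg_cons wdeg_nil addr0.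
  have -> : \sum_t eps t * (part 1 (F x) + part 2 (F x)) (rcons [:: s] t)
      = eps x * (s == a)%:R.
    by rewrite -(F_eps2 xA); apply: eq_bigr => t _; rewrite serD /part /= add0r.
  rewrite /letter eqseq_cons andbT; case: eqVneq => [->|_]; last by rewrite !mulr0.
  by rewrite a_deg sgN1; ring.
rewrite big1 => [|t _]; first by rewrite /letter eqseq_cons andbF !mulr0.
by rewrite serD /part /= size_rcons addr0 mulr0.
Qed.

Definition Theta f : series X := rho deg A (ndiv A (strip deg A eps f)).

(** [rho] and the division by the number of outer letters commute with [delta1], so
    that the homotopy formula for [strip] is transported to Lie series. *)
Lemma Theta_homotopy p f : lhat deg S p f -> supp (fun w => 0 < nout w)%N f ->
  Theta (delta1 f) + delta1 (Theta f) = f.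
Proof.
move=> hf nf.
have cT : cont (fun f => rho deg A (ndiv A f)) := cont_comp (rho_cont _ _) (ndiv_cont _).
have hL := low_dif_lhat.
rewrite /Theta -(rho_sder hL low_dif_nout) -(ndiv_sder hL low_dif_nout) -(contD _ _ cT).
rewrite (strip_homotopy epsA eps_deg aA eps_a (L := low_lin)) //.
- exact: rho_id (lhatT hf) nf.
- by move=> x; apply: lhat_nounit (hL x).
- by move=> x; apply: lhat_homog (hL x).
- exact: low_dif_in.
- exact: low_dif_rstrip.
- move=> x xA w /(low_lin_out xA)[]; case: w => [|y []] // _.
  by rewrite nout1 /=; case: (y \in A).
- by move=> x xA; rewrite /low_dif (negbTE xA).
Qed.

Lemma Theta_supp (P Q : seq X -> Prop) f :
  (forall u t x v w, P (u ++ [:: t, x & v]) -> eps t != 0 -> x \notin A ->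
    nout w = nout (u ++ x :: v) -> size w = size (u ++ x :: v) -> Q w) ->
  supp P f -> supp Q (Theta f).
Proof.
move=> PQ Pf; pose R u := forall w, nout w = nout u -> size w = size u -> Q w.
apply: (supp_rho (P := R)) => [u w Ru nw sw|]; first exact: Ru.
apply: supp_ndiv; apply: (supp_strip _ Pf) => u t x v Pu et xA w nw sw.
exact: PQ Pu et xA nw sw.
Qed.

Definition good m p f := [/\ lhat deg S p f, supp (fun w => 0 < nout w)%N f,
  supp (fun w => m <= wt w)%N f & delta f = 0].

Lemma F_S x : x \in S -> lhat deg S (deg x - 1) (F x).
Proof.
move=> xS; have [xA|xA] := boolP (x \in A); first exact: lhat_sub AS (F_in xA).
have [|r hr ->] := @F_out x; first by rewrite inE xA.
rewrite -[r]scale1r; apply: lhat_lin; first exact: lhat_sub (subsetDl _ _) hr.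
rewrite addrC; apply: lhat_br; last exact: lhat_letter.
by rewrite -a_deg; apply/lhat_letter/(subsetP AS).
Qed.

Lemma delta_nout p f : lhat deg S p f -> supp (fun w => 0 < nout w)%N f ->
  supp (fun w => 0 < nout w)%N (delta f).
Proof.
move=> hf nf; have sf : supp (fun w => 0 < nout w /\ all (mem S) w)%N f.
  by move=> w fw; split; [apply: nf|case: (lhat_supp hf fw)].
apply: supp_sder sf => u x v s [nw]; rewrite all_cat /= => /and3P[_ xS _] Fs.
move: nw; rewrite -cat1s !nout_cat; have [xA|xA] := boolP (x \in A).
  by rewrite nout1 xA; lia.
suff : (0 < nout s)%N by lia.
have xSA : x \in S :\: A by rewrite inE xA.
have [r hr Fx] := F_out xSA; move: Fs; rewrite Fx serD.
have [->|/bracket_supp[-> _]] := eqVneq (sbr (-1) (deg x) (letter a) (letter x) s) 0.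
  rewrite addr0 => rs; have [sS _] := lhat_supp hr rs.
  rewrite lt0n nout_eq0; apply/negP => sA.
  have s0 : s != [::] by apply: contraNneq rs => ->; apply/eqP/(lhat_nounit hr).
  case: s s0 sS sA {rs} => // y s _ /= /andP[]; rewrite inE => /andP[yA _] _.
  by rewrite (negbTE yA).
by rewrite nout1 xA.
Qed.

(** For a cycle, [delta1 f] is the opposite of the higher part of the differential, of
    weight at least [m + 2], and [Theta] lowers weights by 1 only. *)
Lemma Theta_step m p f : good m p f ->
  [/\ lhat deg S (p + 1) (Theta f), supp (fun w => m <= (wt w).+1)%N (Theta f) &
    good m.+1 p (f - delta (Theta f))].
Proof.
case=> hf nf mf df.
have hy : lhat deg S (p + 1) (Theta f).
  apply: rho_lhat; apply: supp_ndiv; apply: (supp_strip _ (lhat_supp hf)) => u t x v [].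
  rewrite !all_cat /= !wdeg_cat !wdeg_cons => /and3P[-> _ ->] <- /eps_deg -> _.
  by split=> //; ring.
have ny : supp (fun w => 0 < nout w)%N (Theta f).
  by apply: Theta_supp nf => u t x v w _ _ xA -> _; rewrite -cat1s !nout_cat nout1 xA; lia.
have mz k g : supp (fun w => k <= wt w)%N g -> supp (fun w => k <= (wt w).+1)%N (Theta g).
  move=> kg; apply: Theta_supp kg => u t x v w kw /epsA tA _ nw sw.
  move: kw; rewrite /wt nw sw -(cat1s t) !nout_cat nout1 tA !size_cat /=; lia.
split=> //; first exact: mz.
have hdy : lhat deg S p (delta (Theta f)).
  by rewrite -[p](addrK 1); apply: sder_lhat F_S hy.
have ndy := delta_nout hy ny.
have sub_lin (P : seq X -> Prop) g h : supp P g -> supp P h -> supp P (g - h).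
  by move=> Pg Ph; rewrite -scaleN1r addrC; apply: supp_lin.
split.
- by rewrite -scaleN1r addrC; apply: lhat_lin.
- exact: (sub_lin).
- pose E := sder deg (fun x => F x - low_dif x) : series X -> series X.
  have EE g : E g = delta g - delta1 g by apply: sderB.
  have Ewt k q g : lhat deg S q g -> supp (fun w => k <= wt w)%N g ->
      supp (fun w => k + 2 <= wt w)%N (E g).
    move=> hg kg; have sg : supp (fun w => k <= wt w /\ all (mem S) w)%N g.
      by move=> w gw; split; [apply: kg|case: (lhat_supp hg gw)].
    apply: supp_sder sg => u x v s []; rewrite all_cat !wt_cat wt_cons.
    by move=> kw /and3P[_ xS _] /(dif_gap xS); lia.
  have d1 g : delta1 g = delta g - E g by rewrite EE opprB addrC subrK.
  have <- : Theta (delta1 f) - E (Theta f) = f - delta (Theta f).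
    have e := Theta_homotopy hf nf; rewrite [delta1 (Theta f)]d1 in e.
    by apply/esym/eqP; rewrite subr_eq -[X in X == _]e addrA addrAC.
  apply: (sub_lin).
    have e : supp (fun w => m + 2 <= wt w)%N (delta1 f).
      by rewrite d1 df; apply: sub_lin (Ewt _ _ _ hf mf) => w; move/eqP; case.
    by apply: supp_sub (mz _ _ e) => w; lia.
  have m1 : supp (fun w => m.-1 <= wt w)%N (Theta f).
    by apply: supp_sub (mz _ _ mf) => w; lia.
  by apply: supp_sub (Ewt _ _ _ hy m1) => w; lia.
have cF := sder_cont deg (fun x => lhat_nounit (gen_dif_lhat D x)).
rewrite -scaleN1r addrC (contP _ _ _ cF) df (sder_sder D (lhatT hy)).
by rewrite scaler0 addr0.
Qed.

(** The corrections [Theta (xi i)] have weight at least [i - 1], while a word of length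
    [l] has weight at most [2 l]: only finitely many of them contribute to a word. *)
Lemma acyclic_out p f : good 0 p f ->
  exists2 g, lhat deg S (p + 1) g & delta g = f.
Proof.
move=> gf; pose next h := h - delta (Theta h).
pose xi i := iter i next f.
have gx i : good i p (xi i) by elim: i => // i /Theta_step[].
have hT i : lhat deg S (p + 1) (Theta (xi i)) by have [] := Theta_step (gx i).
pose y : series X := fun w => \sum_(i < (size w).*2.+2) Theta (xi i) w.
have yE N w : ((size w).*2.+2 <= N)%N -> y w = \sum_(i < N) Theta (xi i) w.
  move=> wN; rewrite /y -(big_mkord xpredT (fun i => Theta (xi i) w)).
  rewrite -(big_mkord xpredT (fun i => Theta (xi i) w)).
  rewrite [RHS](big_cat_nat _ wN) //= [X in _ = _ + X]big_nat_cond
    [X in _ = _ + X]big1 ?addr0 //.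
  move=> i /andP[/andP[wi _] _]; apply/eqP.
  have [_ mT _] := Theta_step (gx i); apply: contraTT wi => /mT.
  have := count_size [predC A] w; rewrite -/(nout w) /wt; lia.
have cF := sder_cont deg (fun x => lhat_nounit (gen_dif_lhat D x)).
exists y => [k|].
  have -> : part k y = \sum_(i < k.*2.+2) part k (Theta (xi i)).
    apply/funext => w; rewrite ser_sum /part; case: eqP => [<-|_]; last by rewrite big1.
    exact: yE.
  by apply: lie_sum => i _; apply: hT.
apply/funext => w; pose N := (size w).*2.+2.
have telescope n : delta (\sum_(i < n) Theta (xi i)) = f - xi n.
  elim: n => [|n IHn]; first by rewrite big_ord0 sder0 subrr.
  rewrite big_ord_recr /= (contD _ _ cF) IHn /next.
  by rewrite opprB [X in _ = _ + X]addrC addrA.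
have ly : low (size w).+1 (y - \sum_(i < N) Theta (xi i)).
  by move=> v vw; rewrite serD serN ser_sum (@yE N) ?subrr // /N; lia.
rewrite -[y](subrK (\sum_(i < N) Theta (xi i))) (contD _ _ cF) serD.
rewrite (sder_local deg (fun x => lhat_nounit (gen_dif_lhat D x)) ly) // add0r.
rewrite telescope serD serN; have [_ _ xw _] := gx N.
have [->|/xw] := eqVneq (xi N w) 0; first by rewrite subr0.
by have := count_size [predC A] w; rewrite -/(nout w) /wt /N; lia.
Qed.

Definition restr f : series X := fun w => if all (mem A) w then f w else 0.

Lemma restr_lin c f g : restr (c *: f + g) = c *: restr f + restr g.
Proof. by apply/funext => w; rewrite !serE /restr; case: ifP => _; rewrite ?mulr0 ?addr0. Qed.

Lemma restr_smul f g : restr (smul f g) = smul (restr f) (restr g).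
Proof.
apply/funext => w; rewrite /restr; case: ifP => wA; last first.
  rewrite /smul big1 // => i _; case: ifP => uA; last by rewrite mul0r.
  case: ifP => vA; last by rewrite mulr0.
  by rewrite -(cat_take_drop i w) all_cat uA vA in wA.
apply: eq_bigr => i _; move: wA; rewrite -{1}(cat_take_drop i w) all_cat.
by move=> /andP[-> ->].
Qed.

Lemma restr_lie k p f : lie deg S k p f -> lie deg A k p (restr f).
Proof.
have restrZ c g : restr (c *: g) = c *: restr g.
  have r0 : restr 0 = 0 by apply/funext => w; rewrite /restr if_same.
  by rewrite -[c *: g]addr0 restr_lin r0 addr0.
elim=> {k p f} [x xS|k p|k p c f g _ IHf _ IHg|k l p q f g _ IHf _ IHg].
- have [xA|xA] := boolP (x \in A).
    have -> : restr (letter x) = letter x.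
      apply/funext => w; rewrite /restr /letter; case: eqVneq => [->|]; last by rewrite if_same.
      by rewrite /= xA.
    exact: lie_letter.
  have -> : restr (letter x) = 0; last exact: lie_zero.
  apply/funext => w; rewrite /restr /letter; case: eqVneq => [->|]; last by rewrite if_same.
  by rewrite /= (negbTE xA).
- have -> : restr 0 = 0 by apply/funext => w; rewrite /restr if_same.
  exact: lie_zero.
- by rewrite restr_lin; apply: lie_lin.
have -> : restr (sbr p q f g) = sbr p q (restr f) (restr g); last exact: lie_br.
by rewrite /sbr -scaleNr addrC restr_lin !restr_smul scaleNr addrC.
Qed.

Lemma restr_lhat p f : lhat deg S p f -> lhat deg A p (restr f).
Proof.
move=> hf k; have -> : part k (restr f) = restr (part k f); last exact: restr_lie.
by apply/funext => w; rewrite /part /restr; case: ifP => //; rewrite if_same.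
Qed.

Theorem relative_acyclic p f : lhat deg S p f -> lhat deg A (p - 1) (delta f) ->
  exists2 g, lhat deg S (p + 1) g & lhat deg A p (f - delta g).
Proof.
move=> hf hdf; have hr := restr_lhat hf.
have hrS := lhat_sub AS hr.
have cF := sder_cont deg (fun x => lhat_nounit (gen_dif_lhat D x)).
have hx : lhat deg S p (f - restr f) by rewrite -scaleN1r addrC; apply: lhat_lin.
have nx : supp (fun w => 0 < nout w)%N (f - restr f).
  move=> w; rewrite serD serN /restr lt0n nout_eq0; case: ifP => //.
  by rewrite subrr eqxx.
have hd : lhat deg A (p - 1) (delta (f - restr f)).
  have -> : f - restr f = -1 *: restr f + f by rewrite scaleN1r addrC.
  by rewrite (contP _ _ _ cF); apply: lhat_lin hdf; apply: sder_lhat F_in hr.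
have d0 : delta (f - restr f) = 0.
  apply/funext => w; apply/eqP/negPn/negP => dw.
  have [wA _] := lhat_supp hd dw; have := delta_nout hx nx dw.
  by rewrite lt0n nout_eq0 wA.
have [|g hg dg] := @acyclic_out p (f - restr f); first by split.
by exists g => //; rewrite dg opprB addrC subrK.
Qed.

End Acyclic.

(** * The counit of the quadratic part of a compatible model *)

Section Counit.
Variables (M : compatible_models) (n : nat).
Implicit Types (s t v x : simplex n).

Definition counit t : rat := (#|val t| == 1%N)%:R.

Local Notation F := (gen_dif (model_dif M n)).

Lemma counit_vertex i : counit (vertex i) = 1.
Proof. by rewrite /counit cards1. Qed.

Lemma counit_neq0 t : counit t != 0 -> #|val t| = 1%N.
Proof. by rewrite /counit; case: (#|val t| =P 1%N) => // _ /eqP. Qed.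

Lemma F_lin v t : F v [:: t] = bd_coef v t.
Proof. exact: (model_lin M). Qed.

Lemma F_faces v : lhat (@sdeg n) (faces v) (sdeg v - 1) (F v).
Proof. exact: model_faces. Qed.

Lemma F_low v : F v [::] = 0.
Proof. exact: lhat_nounit (F_faces v). Qed.

Lemma bd_coef_facet v t i : i \in val v -> val t = val v :\ i -> bd_coef v t != 0.
Proof.
move=> iv tv; rewrite /bd_coef (bigD1 i) /=; last by rewrite iv tv eqxx.
rewrite big1 ?addr0 ?signr_eq0 // => j /andP[/andP[jv /eqP tj] ji].
have e : val v :\ i = val v :\ j := etrans (esym tv) tj.
by have := setD11 j (val v); rewrite -e !inE ji jv.
Qed.

(** The augmentation of simplicial chains: an edge has two vertices, with opposite
    signs. *)
Lemma counit_bd v : \sum_t counit t * bd_coef v t = 0.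
Proof.
have [/eqP/cards2P[x [y [xy vE]]]|v2] := eqVneq #|val v| 2%N; last first.
  apply: big1 => t _; have [->|/counit_neq0 t1] := eqVneq (counit t) 0; first by rewrite mul0r.
  rewrite /bd_coef big1 ?mulr0 // => i /andP[iv /eqP tv].
  by case/eqP: v2; rewrite (cardsD1 i) iv -tv t1.
wlog lt_xy : x y xy vE / (x < y)%N.
  move=> H; have [|yx|/val_inj e] := ltngtP x y; first exact: H.
    by apply: (H y x) => //; [rewrite eq_sym|rewrite setUC].
  by rewrite e eqxx in xy.
rewrite (eq_bigr (fun t => \sum_(i in val v | val t == val v :\ i)
   counit t * (-1) ^+ #|[set j in val v | (j < i)%N]|)); last first.
  by move=> t _; rewrite mulr_sumr.
rewrite (exchange_big_dep (mem (val v))) /=; last by move=> t i _ /andP[].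
have sub1 i : i \in val v ->
    \sum_(t | val t == val v :\ i) counit t * (-1) ^+ #|[set j in val v | (j < i)%N]|
    = (-1) ^+ #|[set j in val v | (j < i)%N]| :> rat.
  move=> iv; have c1 : #|val v :\ i| = 1%N.
    by have := cardsD1 i (val v); rewrite iv vE cards2 xy => -[].
  have s0 : val v :\ i != set0 by rewrite -card_gt0 c1.
  pose s : simplex n := exist _ (val v :\ i) s0; rewrite (bigD1 s) //= big1 ?addr0 => [|t /andP[/eqP ti]]; last first.
    by move=> /eqP[]; apply: val_inj.
  by rewrite /counit /= c1 mul1r.
transitivity (\sum_(i in val v) (-1) ^+ #|[set j in val v | (j < i)%N]| : rat).
  by apply: eq_bigr => i iv; rewrite -[RHS]sub1 //; apply: eq_bigl => t; rewrite iv.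
rewrite vE big_setU1 ?inE //= big_set1.
have -> : [set j in [set x; y] | (j < x)%N] = set0.
  apply/setP => j; rewrite !inE; apply/negP => /andP[/orP[]/eqP->]; lia.
have -> : [set j in [set x; y] | (j < y)%N] = [set x].
  apply/setP => j; rewrite !inE; case: (eqVneq j x) => [->|_] //=.
  by case: (eqVneq j y) => [->|//]; rewrite ltnn.
by rewrite cards0 cards1 expr0 expr1 subrr.
Qed.

(** The coefficient of [s] in the contraction of the quadratic part of the
    differential of [v] with the counit on the right. *)
Definition cocomp v s : rat := \sum_t counit t * F v [:: s; t].

(** Contracting with a vertex, of degree [-1], leaves [s] in the degree of [v], and [s]
    is a face of [v]. *)
Lemma cocomp_neq v s : s != v -> cocomp v s = 0.
Proof.
move=> sv; apply: big1 => t _.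
have [->|/counit_neq0 t1] := eqVneq (counit t) 0; first by rewrite mul0r.
have [->|/(lhat_supp (@F_faces v))[st]] := eqVneq (F v [:: s; t]) 0; first by rewrite mulr0.
rewrite !wdeg_cons wdeg_nil /sdeg t1 => e; move: st => /= /andP[]; rewrite inE => sub _.
have {}e : #|val s| = #|val v| by lia.
by case/eqP: sv; apply: val_inj; apply/eqP; rewrite eqEcard e leqnn andbT.
Qed.

Lemma cocomp_vertex i : cocomp (vertex i) (vertex i) = -1.
Proof.
have /(congr1 (@free_val _ _ _)) := model_mc M i.
rewrite addrC free_val_lin /= => /eqP; rewrite addrC addr_eq0 => /eqP.
rewrite [X in X = _](dif_sder (model_dif M n)) /= sder_letter => Fi.
rewrite /cocomp Fi.
have e t : (- (2^-1 *: sbr (-1) (-1) (letter (vertex i)) (letter (vertex i))))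
    [:: vertex i; t] = - (t == vertex i)%:R :> rat.
  rewrite /sbr mulrNN mulr1 expr1z scaleN1r opprK.
  rewrite !serE !smul_letter eqxx mul1r /letter eqseq_cons andbT.
  by field.
rewrite (bigD1 (vertex i)) //= e eqxx counit_vertex big1 ?addr0 ?mul1r // => t ti.
by rewrite e (negbTE ti) oppr0 mulr0.
Qed.

(** Coefficient of [s] in the contraction of the quadratic part of the square of the
    differential; the third term of the Leibniz rule vanishes by [counit_bd]. *)
Lemma cocomp_facet v s : bd_coef v s * (cocomp v v + cocomp s s) = 0.
Proof.
have F0 x : nounit (F x) by apply: F_low.
have dd t : \sum_x (F x [:: s] * F v [:: x; t] + F x [:: s; t] * F v [:: x])
    + sg (sdeg s) * \sum_x F x [:: t] * F v [:: s; x] = 0.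
  have := sder_sder (model_dif M n) (lhat_letter (@sdeg n) (in_setT v)).
  rewrite sder_letter => /(congr1 (fun g => g [:: s; t])).
  rewrite ser0 /= => e; rewrite -[RHS]e; congr (_ + _ * _).
    apply: eq_bigr => x _; rewrite /smul !big_ord_recl big_ord0 /= F0 /lder.
    by rewrite mul0r add0r addr0.
  rewrite [X in _ = _ + _ * (X + _)]big1 ?addr0 => [|x _]; last by rewrite smul_nil F0 mul0r.
  rewrite mulr0 addr0; apply: eq_bigr => x _.
  by rewrite /smul !big_ord_recl big_ord0 /= F0 /lder mul0r add0r addr0.
have : \sum_t counit t * (\sum_x (F x [:: s] * F v [:: x; t] + F x [:: s; t] * F v [:: x])
    + sg (sdeg s) * \sum_x F x [:: t] * F v [:: s; x]) = 0.
  by apply: big1 => t _; rewrite dd mulr0.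
under eq_bigr => t _ do rewrite mulrDr.
rewrite big_split /=.
have -> : \sum_t counit t * (sg (sdeg s) * \sum_x F x [:: t] * F v [:: s; x]) = 0.
  rewrite (eq_bigr (fun t => \sum_x sg (sdeg s) * F v [:: s; x] * (counit t * bd_coef x t))).
    by rewrite exchange_big /= big1 // => x _; rewrite -mulr_sumr counit_bd mulr0.
  by move=> t _; rewrite !mulr_sumr; apply: eq_bigr => x _; rewrite -F_lin; ring.
rewrite addr0 (eq_bigr (fun t => \sum_x (F x [:: s] * (counit t * F v [:: x; t])
    + F v [:: x] * (counit t * F x [:: s; t])))); last first.
  by move=> t _; rewrite mulr_sumr; apply: eq_bigr => x _; ring.
rewrite exchange_big /=; under eq_bigr => x _ do rewrite big_split /= -!mulr_sumr.
rewrite big_split /= (bigD1 v) //= [X in _ + X + _]big1 ?addr0; last first.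
  by move=> x xv; rewrite -/(cocomp v x) cocomp_neq ?mulr0.
rewrite [X in _ + X](bigD1 s) //= [X in _ + (_ + X)]big1 ?addr0; last first.
  by move=> x xs; rewrite -/(cocomp x s) cocomp_neq ?mulr0 // eq_sym.
by rewrite -!/(cocomp _ _) F_lin -mulrDr.
Qed.

(** Induction on the dimension, through any facet of [v]. *)
Lemma cocomp_diag v : cocomp v v = sg (sdeg v).
Proof.
have [m] := ubnP #|val v|; elim: m v => // m IHm v; rewrite ltnS => vm.
have /set0Pn[i iv] := valP v; have [v1|v1] := eqVneq (val v :\ i) set0.
  have -> : v = vertex i.
    by apply: val_inj; apply/eqP; rewrite eqEsubset sub1set iv andbT /= -setD_eq0; apply/eqP.
  by rewrite cocomp_vertex sdeg_vertex sgN1.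
have [s sE] : exists s : simplex n, val s = val v :\ i by exists (exist _ (val v :\ i) v1).
have vs : #|val v| = #|val s|.+1 by rewrite sE (cardsD1 i) iv.
have /eqP := cocomp_facet v s; rewrite mulf_eq0 (negbTE (bd_coef_facet iv sE)) /=.
rewrite addr_eq0 (IHm s); last by rewrite -vs.
have -> : sdeg s = sdeg v - 1 by rewrite /sdeg vs; lia.
by rewrite sgB1 opprK => /eqP.
Qed.

End Counit.

(** * The twisted differential of a model *)

Section Letters.
Variable X : finType.
Implicit Types x y s t : X.

Lemma sbr_letters1 p q x y t : sbr p q (letter x) (letter y) [:: t] = 0.
Proof. by rewrite /sbr !serE !smul_letter !mulr0 subrr. Qed.

Lemma sbr_letters2 p q x y s t : sbr p q (letter x) (letter y) [:: s; t]
  = (s == x)%:R * (t == y)%:R - sg (p * q) * ((s == y)%:R * (t == x)%:R).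
Proof. by rewrite /sbr !serE !smul_letter /letter !eqseq_cons !andbT. Qed.

Lemma sum_sbr_letters (c : X -> rat) p q x y s :
  \sum_t c t * sbr p q (letter x) (letter y) [:: s; t]
  = c y * (s == x)%:R - sg (p * q) * (c x * (s == y)%:R).
Proof.
have sum_delta (k : rat) z : \sum_t c t * (k * (t == z)%:R) = c z * k.
  rewrite (bigD1 z) //= eqxx mulr1 big1 ?addr0 // => t /negbTE ->.
  by rewrite !mulr0.
under eq_bigr => t _ do rewrite sbr_letters2 mulrBr [X in _ - _ * X]mulrA.
by rewrite sumrB !sum_delta mulrCA.
Qed.
End Letters.

Section Twisted.
Variables (M : compatible_models) (n : nat) (i : 'I_n.+1) (A S : {set simplex n}).
Hypothesis AS : A \subset S.
Hypothesis iA : vertex i \in A.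
Hypothesis A_faces : forall x, x \in A -> faces x \subset A.
Hypothesis out_faces : forall x, x \in S :\: A -> faces x \subset S :\: A.

Definition twisted_dif : differential (Lhat n) := dgl_dif (twist (model_mc M i)).

Local Notation F := (gen_dif twisted_dif).
Local Notation F0 := (gen_dif (model_dif M n)).

Lemma gen_twisted x :
  F x = F0 x + sbr (-1) (sdeg x) (letter (vertex i)) (letter x).
Proof. by []. Qed.

Lemma gen_twisted_coef x w :
  F x w = F0 x w + sbr (-1) (sdeg x) (letter (vertex i)) (letter x) w.
Proof. by []. Qed.

(** The counit has to vanish outside [A]: deleting a vertex that does not belong to the
    component would not be compatible with the count of outer letters. *)
Definition counit_on (t : simplex n) : rat := (t \in A)%:R * counit t.

Lemma counit_on_neq0 t : counit_on t != 0 -> t \in A /\ #|val t| = 1%N.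
Proof.
rewrite /counit_on; case: (t \in A); last by rewrite mul0r eqxx.
by rewrite mul1r => /counit_neq0.
Qed.

Lemma counit_on_sum (x : simplex n) w : x \in A ->
  \sum_t counit_on t * F0 x (rcons w t) = \sum_t counit t * F0 x (rcons w t).
Proof.
move=> xA; apply: eq_bigr => t _; rewrite /counit_on.
have [->|/(lhat_supp (@F_faces M n x))[]] := eqVneq (F0 x (rcons w t)) 0; first by rewrite !mulr0.
rewrite all_rcons => /andP[tx _] _.
by rewrite (subsetP (A_faces xA)) ?mul1r.
Qed.

Lemma counit_on_twisted1 x : x \in A -> \sum_t counit_on t * F x [:: t] = 0.
Proof.
move=> xA; transitivity (\sum_t counit_on t * F0 x (rcons [::] t)).
  by apply: eq_bigr => t _; rewrite gen_twisted_coef sbr_letters1 addr0.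
rewrite counit_on_sum // -[RHS](counit_bd x).
by apply: eq_bigr => t _; congr (_ * _); apply: F_lin.
Qed.

Lemma counit_on_twisted2 x s : x \in A ->
  \sum_t counit_on t * F x [:: s; t] = counit_on x * (s == vertex i)%:R.
Proof.
move=> xA; have cE : \sum_t counit_on t * F0 x [:: s; t] = sg (sdeg x) * (s == x)%:R.
  rewrite -[LHS]/(\sum_t counit_on t * F0 x (rcons [:: s] t)) counit_on_sum //.
  rewrite -[LHS]/(cocomp M x s); have [->|sx] := eqVneq s x.
    by rewrite cocomp_diag mulr1.
  by rewrite cocomp_neq // mulr0.
have {cE} -> : \sum_t counit_on t * F x [:: s; t] =
    sg (sdeg x) * (s == x)%:R
    + \sum_t counit_on t * (sbr (-1) (sdeg x) (letter (vertex i)) (letter x) [:: s; t]).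
  by rewrite -cE -big_split; apply: eq_bigr => t _; rewrite gen_twisted_coef mulrDr.
rewrite (sum_sbr_letters counit_on) mulN1r sgN.
have -> : counit_on (vertex i) = 1 by rewrite /counit_on iA mul1r counit_vertex.
by rewrite mul1r addrC subrK.
Qed.

Lemma twisted_relative_acyclic p q (h : p - 1 = q) (x : Lhat n p) :
  lhat (@sdeg n) S p (free_val x) -> lhat (@sdeg n) A q (free_val (dif twisted_dif h x)) ->
  exists2 y : Lhat n (p + 1), lhat (@sdeg n) S (p + 1) (free_val y) &
    lhat (@sdeg n) A p (free_val (x - dif twisted_dif (addrK 1 p) y)).
Proof.
case: q / h => hx; rewrite dif_sder => hdx.
have epsI : counit_on (vertex i) = 1 by rewrite /counit_on iA mul1r counit_vertex.
have [||||||y hy hxy] := @relative_acyclic _ (@sdeg n) twisted_dif A S counit_on (vertex i)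
  AS iA (sdeg_vertex i) epsI _ _ _ _ _ _ p (free_val x) hx hdx.
- by move=> t /counit_on_neq0[].
- by move=> t /counit_on_neq0[_ t1]; rewrite /sdeg t1.
- move=> y yA; rewrite gen_twisted -[F0 y]scale1r; apply: lhat_lin.
    exact: lhat_sub (A_faces yA) (@F_faces M n y).
  by rewrite -(sdeg_vertex i) addrC; apply: lhat_br; apply: lhat_letter.
- move=> y yS; exists (F0 y); last exact: gen_twisted.
  exact: lhat_sub (out_faces yS) (@F_faces M n y).
- exact: counit_on_twisted1.
- by move=> y yA s; apply: counit_on_twisted2.
have hy' : y \in free_pred (@sdeg n) (p + 1) by apply/asboolP/lhatT/hy.
exists (FreeElt hy') => //.
rewrite -scaleN1r addrC free_val_lin dif_sder /= scaleN1r addrC.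
exact: hxy.
Qed.
End Twisted.

(** * From relative acyclicity to quasi-isomorphisms *)

Lemma bijective_inj_surj (U V : Type) (g : U -> V) :
  injective g -> (forall y, exists x, g x = y) -> bijective g.
Proof.
move=> gI /choice[k kP]; exists k => // x.
by apply: gI; rewrite kP.
Qed.

(** The second hypothesis is the acyclicity of the quotient complex: applied to cycles
    it gives surjectivity in homology, applied to a chain whose
    boundary lies in the image it gives injectivity. *)
Lemma quasi_iso_relative (L L' : dgl) (g : dgl_mor L L') :
  (forall p, injective (@gm_fun _ _ g p)) ->
  (forall p q (h : p - 1 = q) (x : L' p), (exists z, d h x = g q z) ->
    exists (y : L' (p + 1)) z, x - d (addrK 1 p) y = g p z) ->
  quasi_iso g.
Proof.
move=> gI gH p; apply: bijective_inj_surj => [c c'|c].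
  rewrite -[c]reprK -[c']reprK !homology_mapE => /eqP.
  rewrite -Quotient.idealrBE => /asboolP[y yE].
  set z := repr c in yE *; set z' := repr c' in yE *.
  have {}yE : d (addrK 1 p) y = g p (val z - val z') by rewrite yE [RHS]raddfB.
  have [|y' [u uE]] := gH _ _ (addrK 1 p) y; first by exists (val z - val z').
  apply/eqP; rewrite -Quotient.idealrBE; apply/asboolP; exists u.
  apply: gI; rewrite dm_dif -uE raddfB /= yE.
  by rewrite [d _ (d _ _)](dif_dif (dgl_dif L')) subr0.
have zc : d (erefl (p - 1)) (val (repr c)) = 0 by have /eqP := cycleP (repr c).
have [|y [u uE]] := gH _ _ (erefl (p - 1)) (val (repr c)).
  by exists 0; rewrite zc raddf0.
have uc : u \in @is_cycle L p.
  apply/eqP/gI; rewrite dm_dif -uE raddfB raddf0 /= zc.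
  by rewrite [d _ (d _ _)](dif_dif (dgl_dif L')) subr0.
exists (\pi_(homology L p) (Cycle uc)); rewrite homology_mapE -[RHS]reprK.
apply/eqP; rewrite -Quotient.idealrBE; apply/asboolP; exists (- y).
by rewrite raddfN /= -uE addrAC subrr add0r.
Qed.

(** All vertices of a simplex are joined by edges. *)
Lemma component_face (T : finType) (K : scomplex T) (a : T) (s t : {set T}) :
  s \in simplices K -> t \subset s -> t \in simplices (component K a) ->
  s \in simplices (component K a).
Proof.
move=> sK ts; rewrite !inE sK => /andP[tK /subsetP ta] /=.
have /set0Pn[x xt] : t != set0 by apply: contraNneq (simplices_neq0 K) => <-.
apply/subsetP => y ys; have := ta x xt; rewrite !inE => /connect_trans -> //.
apply: connect1; apply: (simplices_face sK).
  by apply/subsetP => z /set2P[]-> //; apply: (subsetP ts).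
by apply/set0Pn; exists x; rewrite !inE eqxx.
Qed.

(** Injectivity of [f] on vertices is what lets a face of the image of a simplex come
    from a face of that simplex. *)
Lemma embed_component_out (T : finType) n (f : T -> 'I_n.+1) (K : scomplex T) (a : T) :
  {in [pred v | [set v] \in simplices K] &, injective f} ->
  forall x, x \in simplex_set (embed f K) :\: simplex_set (embed f (component K a)) ->
  faces x \subset simplex_set (embed f K) :\: simplex_set (embed f (component K a)).
Proof.
move=> f_inj x; rewrite 2!inE => /andP[xA xK]; apply/subsetP => t; rewrite [_ \in faces _]inE => tx.
rewrite 2!inE; move: (xK); rewrite inE => xK'.
rewrite [t \in simplex_set (embed f K)]inE (simplices_face xK' tx (valP t)) andbT.
apply: contra xA => /imsetP[t' t'A tE].
have /imsetP[s sK sE] := xK'; rewrite sE; apply: imset_f.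
apply: (component_face sK _ t'A); apply/subsetP => y yt.
have t'K : t' \in simplices K by move: t'A; rewrite inE => /andP[].
have vert (r : {set T}) z : r \in simplices K -> z \in r -> [set z] \in simplices K.
  move=> rK zr; apply: (simplices_face rK); first by rewrite sub1set.
  by apply/set0Pn; exists z; rewrite inE.
have /imsetP[z zs fyz] : f y \in f @: s.
  by rewrite -sE; apply: (subsetP tx); rewrite tE; apply: imset_f.
by rewrite (f_inj y z) // inE; [apply: vert t'K yt|apply: vert sK zs].
Qed.

Theorem proposition5p1
  (M : compatible_models)
  (T : finType) (K : scomplex T) (a : T) (aK : [set a] \in simplices K)
  (n : nat) (f : T -> 'I_n.+1)
  (f_inj : {in [pred v | [set v] \in simplices K] &, injective f}) :
  quasi_iso (component_incl M f aK
    : dgl_mor (twisted_model M f (component_vertex aK)) (twisted_model M f aK)).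
Proof.
pose A := simplex_set (embed f (component K a)); pose S := simplex_set (embed f K).
have AS : A \subset S.
  apply/subsetP => s; rewrite !inE => /imsetP[t]; rewrite inE => /andP[tK _] ->.
  exact: imset_f.
have aA : vertex (f a) \in A.
  rewrite inE; apply/imsetP; exists [set a]; last by rewrite imset_set1.
  exact: component_vertex.
have A_faces x : x \in A -> faces x \subset A.
  rewrite inE => xA; apply/subsetP => t; rewrite !inE => tx.
  exact: simplices_face xA tx (valP t).
apply: quasi_iso_relative => [p x y /(congr1 val) e|p q h x [z zE]].
  exact: val_inj.
have hx : lhat (@sdeg n) S p (free_val (val x)) by apply/asboolP/(valP x).
have hdx : lhat (@sdeg n) A q (free_val (dif (twisted_dif M (f a)) h (val x))).
  have -> : dif (twisted_dif M (f a)) h (val x) = val z by have /(congr1 val) := zE.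
  by apply/asboolP/(valP z).
have [y hy hxy] := twisted_relative_acyclic AS aA A_faces
  (embed_component_out f_inj) hx hdx.
have yS : y \in @sub_pred _ (submodel M (embed f K)) (p + 1) by apply/asboolP.
pose w : Lhat n p := val x - dif (twisted_dif M (f a)) (addrK 1 p) y.
have wA : w \in @sub_pred _ (submodel M (embed f (component K a))) p by apply/asboolP.
exists (SubdglElt yS), (SubdglElt wA).
exact: val_inj.
Qed.
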